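(* Let $G$ be a compact group and $n\ge1$. With pointwise addition and pointwise multiplication, the space $V^n(G)$ is a commutative Banach algebra.
   Context: $C(G)$ is the commutative C*-algebra of continuous complex-valued functions on $G$. $V^n(G)$ is the (completed) $(n+1)$-fold Haagerup tensor product $C(G)\otimes^h\cdots\otimes^h C(G)$, with the Haagerup norm $\|\cdot\|_V$; its elements are regarded as continuous functions on $G^{n+1}$, an elementary tensor $\phi^1\otimes\cdots\otimes\phi^{n+1}$ corresponding to $(x_1,\ldots,x_{n+1})\mapsto\phi^1(x_1)\cdots\phi^{n+1}(x_{n+1})$. *)

(* Defs.v *)
From HB Require Import structures.
From mathcomp Require Import all_boot all_order all_algebra.
From mathcomp Require Import complex.
From mathcomp Require Import all_classical all_reals all_analysis.

Set Implicit Arguments.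
Unset Strict Implicit.
Unset Printing Implicit Defensive.

Import Order.TTheory GRing.Theory Num.Theory.
Import numFieldNormedType.Exports.

Local Open Scope classical_set_scope.
Local Open Scope ring_scope.

HB.mixin Record isTopologicalGroup G of Group G & Topological G := {
  mulg_continuous : continuous (fun z : G * G => (z.1 * z.2)%g);
  invg_continuous : continuous (fun x : G => (x^-1)%g)
}.

#[short(type="topologicalGroupType")]
HB.structure Definition TopologicalGroup :=
  {G of Group G & Topological G & isTopologicalGroup G}.

(* The complex numbers, packed as a numClosedFieldType so that they carry the
   topology and the module structure induced by the modulus. *)
Definition Cplx (R : realType) : numClosedFieldType := (R[i])%C.

Definition cabs (R : realType) (z : Cplx R) : R := Normc.normc z.

Section HaagerupTensor.
Variables (R : realType) (G : topologicalType).

Definition vnorm2 p (v : 'cV[Cplx R]_p) : R :=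
  Num.sqrt (\sum_i cabs (v i 0) ^+ 2).

Definition opnorm p q (M : 'M[Cplx R]_(p, q)) : R :=
  sup [set vnorm2 (M *m v) | v in [set v : 'cV[Cplx R]_q | vnorm2 v <= 1]].

(* M_{p,q}(C(G)) is identified with the continuous functions from G to
   M_{p,q}(C); its operator-space norm is then the supremum of the pointwise
   operator norms. *)
Definition mx_continuous p q (a : G -> 'M[Cplx R]_(p, q)) : Prop :=
  forall i j, continuous (fun x => a x i j).

Definition mxC_norm p q (a : G -> 'M[Cplx R]_(p, q)) : R :=
  sup (range (fun x => opnorm (a x))).

(* chain a y m = a_0(y_0) a_1(y_1) ... a_(m-1)(y_(m-1)) *)
Fixpoint chain (d : nat -> nat)
    (a : forall k, G -> 'M[Cplx R]_(d k, d k.+1)) (y : nat -> G) (m : nat) :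
    'M[Cplx R]_(d 0%N, d m) :=
  if m is m'.+1 then chain a y m' *m a m' (y m') else 1%:M.

Variable n : nat.

Local Notation funs := (('I_n.+1 -> G) -> Cplx R).

(* The algebraic tensor product of n+1 copies of C(G), realised inside the
   functions on G^(n+1) as the span of the elementary tensors. *)
Definition alg_tensor (u : funs) : Prop :=
  exists (r : nat) (phi : 'I_r -> 'I_n.+1 -> G -> Cplx R),
    (forall j i, continuous (phi j i)) /\
    u = (fun x => \sum_(j < r) \prod_(i < n.+1) phi j i (x i)).

(* u = a_0 (.) a_1 (.) ... (.) a_n, where a_0 is a row, a_n is a column, and
   a_k is a matrix over C(G) of size d k by d (k+1).  Only the matrices a_k
   with k <= n matter. The equality is one of 1 by 1 matrices. *)
Definition factorization (u : funs) (d : nat -> nat)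
    (a : forall k, G -> 'M[Cplx R]_(d k, d k.+1)) : Prop :=
  [/\ d 0%N = 1%N, d n.+1 = 1%N,
      forall k, (k <= n)%N -> mx_continuous (a k)
    & forall x : 'I_n.+1 -> G,
        chain a (fun k => x (inord k)) n.+1 = const_mx (u x)].

Definition haagerup_norm (u : funs) : R :=
  inf [set r | exists d (a : forall k, G -> 'M[Cplx R]_(d k, d k.+1)),
    factorization u a /\ r = \prod_(k < n.+1) mxC_norm (a k)].

Definition cauchy_for (E : zmodType) (N : E -> R) (u : nat -> E) : Prop :=
  forall e : R, 0 < e -> exists K : nat, forall k l : nat,
    (K <= k)%N -> (K <= l)%N -> N (u k - u l) < e.

Definition haagerup_cauchy (u : nat -> funs) : Prop :=
  (forall k, alg_tensor (u k)) /\ cauchy_for haagerup_norm u.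

(* The element of the completion defined by the Cauchy sequence u, regarded as
   a function on G^(n+1), is f. *)
Definition represents (u : nat -> funs) (f : funs) : Prop :=
  haagerup_cauchy u /\ {uniform, u @ \oo --> f}.

Definition Vn : set funs := [set f | exists u, represents u f].

(* The norm of the completion: the limit of the Haagerup norms along a Cauchy
   sequence representing f. *)
Definition Vn_norm (f : funs) : R :=
  xget 0 [set r | exists2 u, represents u f
                           & haagerup_norm (u k) @[k --> \oo] --> r].

End HaagerupTensor.

(* The subset A of E, with the linear structure of E, the product mul and the
   norm N, is a (not necessarily unital) commutative complex Banach algebra. *)
Record commutative_banach_algebra (R : realType) (E : lmodType (Cplx R))
    (A : set E) (mul : E -> E -> E) (N : E -> R) : Prop := {
  cba_zero : A 0;
  cba_add : forall f g, A f -> A g -> A (f + g);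
  cba_scale : forall (c : Cplx R) f, A f -> A (c *: f);
  cba_mul : forall f g, A f -> A g -> A (mul f g);
  cba_mulA : forall f g h, A f -> A g -> A h ->
    mul f (mul g h) = mul (mul f g) h;
  cba_mulC : forall f g, A f -> A g -> mul f g = mul g f;
  cba_mulDl : forall f g h, A f -> A g -> A h ->
    mul (f + g) h = mul f h + mul g h;
  cba_scaleAl : forall (c : Cplx R) f g, A f -> A g ->
    mul (c *: f) g = c *: mul f g;
  cba_norm_ge0 : forall f, A f -> 0 <= N f;
  cba_norm_eq0 : forall f, A f -> N f = 0 -> f = 0;
  cba_normD : forall f g, A f -> A g -> N (f + g) <= N f + N g;
  cba_normZ : forall (c : Cplx R) f, A f -> N (c *: f) = cabs c * N f;
  cba_normM : forall f g, A f -> A g -> N (mul f g) <= N f * N g;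
  cba_complete : forall u : nat -> E, (forall k, A (u k)) -> cauchy_for N u ->
    exists2 f, A f & N (u k - f) @[k --> \oo] --> (0 : R)
}.

(* Main.v *)
Require Import Defs.
From HB Require Import structures.
From mathcomp Require Import all_boot all_order all_algebra.
From mathcomp Require Import complex finmap.
From mathcomp Require Import ring lra.
From mathcomp Require Import all_classical all_reals all_analysis.
Set Implicit Arguments.
Unset Strict Implicit.
Unset Printing Implicit Defensive.
Import Order.TTheory GRing.Theory Num.Theory.
Import numFieldNormedType.Exports.
Local Open Scope classical_set_scope.
Local Open Scope ring_scope.

(* The delicate point is that the norm of the completion is well defined, i.e.
   that the completion injects into the functions on G^(n+1).  It follows from
   the lower semicontinuity of the Haagerup norm, on the algebraic tensor
   product, for uniform convergence, which comes from the metric approximation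
   property of C(G): given an algebraic tensor u, choose points s_j and a
   partition of unity h_j subordinate to a finite cover of G on which the
   functions occurring in u almost do not vary.  Applying f |-> sum_j f(s_j) h_j
   in each variable is an operator P which replaces the matrices of a
   factorization by convex combinations of their values, so that it does not
   increase the Haagerup norm; P u is close to u in Haagerup norm; and P (u - w)
   is a finite sum of elementary tensors weighted by values of u - w, hence is
   small as soon as u - w is uniformly small.
   Subadditivity and submultiplicativity of the norm come from block diagonal
   sums and Kronecker products of factorizations. *)

(** * Contractive matrices indexed by finite types *)

Section Modulus.
Variable R : realType.
Local Notation K := (Cplx R).
Implicit Types z w : K.

Definition rC (x : R) : K := (x%:C)%C.

Lemma cabsM z w : cabs (z * w) = cabs z * cabs w.
Proof. exact: Normc.normcM. Qed.

Lemma cabs_ge0 z : 0 <= cabs z.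
Proof. by case: z => a b; rewrite /cabs /= sqrtr_ge0. Qed.

Lemma cabs0 : cabs (0 : K) = 0.
Proof. exact: Normc.normc0. Qed.

Lemma cabs1 : cabs (1 : K) = 1.
Proof. exact: Normc.normc1. Qed.

Lemma cabs_eq0 z : cabs z = 0 -> z = 0.
Proof. exact: Normc.eq0_normc. Qed.

Lemma cabsD z w : cabs (z + w) <= cabs z + cabs w.
Proof. exact: le_normcD. Qed.

Lemma cabsN z : cabs (- z) = cabs z.
Proof. exact: normcN. Qed.

Lemma cabsB z w : cabs (z - w) = cabs (w - z).
Proof. by rewrite -cabsN opprB. Qed.

Lemma cabsV z : cabs z^-1 = (cabs z)^-1.
Proof. exact: Normc.normcV. Qed.

Lemma cabs_norm z : `|z| = rC (cabs z).
Proof. by case: z. Qed.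

Lemma cabs_sum (I : finType) (F : I -> K) :
  cabs (\sum_i F i) <= \sum_i cabs (F i).
Proof.
elim/big_ind2: _ => [|x a y b xa yb|//]; first by rewrite cabs0.
exact: le_trans (cabsD _ _) (lerD xa yb).
Qed.

Lemma cabs_rC (x : R) : cabs (rC x) = `|x|.
Proof. by rewrite /cabs /rC /= expr0n /= addr0 sqrtr_sqr. Qed.

Lemma rCM (x y : R) : rC (x * y) = rC x * rC y.
Proof. exact: rmorphM. Qed.

Lemma rC_sum (I : finType) (F : I -> R) : rC (\sum_i F i) = \sum_i rC (F i).
Proof. exact: rmorph_sum. Qed.

Lemma rCV (x : R) : rC x^-1 = (rC x)^-1.
Proof. exact: fmorphV. Qed.

Lemma rC_inj : injective rC.
Proof. by move=> x y []. Qed.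

Lemma cabs_rC_ge0 (x : R) : 0 <= x -> cabs (rC x) = x.
Proof. by move=> x0; rewrite cabs_rC ger0_norm. Qed.

End Modulus.

Section Contractions.
Variable R : realType.
Local Notation K := (Cplx R).

Definition sqn (I : finType) (v : I -> K) : R := \sum_i cabs (v i) ^+ 2.

(** Squared Euclidean norms avoid square roots. Arbitrary finite index types let direct sums and
    tensor products be indexed by [I + J] and [I * J] without casts; a row is a matrix whose first
    index type is [unit]. *)
Definition contr (I J : finType) (M : I -> J -> K) :=
  forall v : J -> K, sqn (fun i => \sum_j M i j * v j) <= sqn v.

Lemma sqn_ge0 (I : finType) (v : I -> K) : 0 <= sqn v.
Proof. by apply: sumr_ge0 => i _; rewrite sqr_ge0. Qed.

Lemma sqn_unit (v : unit -> K) : sqn v = cabs (v tt) ^+ 2.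
Proof. by rewrite /sqn (big_pred1 tt) //; case. Qed.

Lemma sqnZ (I : finType) c (v : I -> K) :
  sqn (fun i => c * v i) = cabs c ^+ 2 * sqn v.
Proof. by rewrite mulr_sumr; apply: eq_bigr => i _; rewrite cabsM exprMn. Qed.

Lemma sqn_sum (I J : finType) (v : I + J -> K) :
  sqn v = sqn (fun i => v (inl i)) + sqn (fun j => v (inr j)).
Proof. by rewrite /sqn big_sumType. Qed.

Lemma contr_mul (I J L : finType) (M : I -> J -> K) (N : J -> L -> K) :
  contr M -> contr N -> contr (fun i l => \sum_j M i j * N j l).
Proof.
move=> cM cN v; apply: le_trans (cN v).
apply: le_trans (cM (fun j => \sum_l N j l * v l)).
rewrite le_eqVlt; apply/orP; left; apply/eqP; congr sqn; apply/funext => i.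
under eq_bigr do rewrite mulr_suml.
rewrite exchange_big /=; apply: eq_bigr => j _.
by rewrite mulr_sumr; apply: eq_bigr => l _; rewrite mulrA.
Qed.

(** The Kronecker product is the composite of [N] acting on the second coordinate, whose result is
    [w], and [M] acting on the first; each is contractive slice by slice. *)
Lemma contr_tens (I J I' J' : finType) (M : I -> J -> K) (N : I' -> J' -> K) :
  contr M -> contr N ->
  contr (fun (p : I * I') (q : J * J') => M p.1 q.1 * N p.2 q.2).
Proof.
move=> cM cN v.
pose w j i' := \sum_j' N i' j' * v (j, j').
have -> : sqn (fun p : I * I' => \sum_q M p.1 q.1 * N p.2 q.2 * v q) =
    \sum_i' sqn (fun i => \sum_j M i j * w j i').
  rewrite /sqn exchange_big /= pair_bigA /=; apply: eq_bigr => -[i i'] _ /=.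
  congr (cabs _ ^+ 2).
  rewrite (eq_bigr (fun j => \sum_j' M i j * N i' j' * v (j, j'))).
    by rewrite pair_bigA /=; apply: eq_bigr => -[].
  by move=> j _; rewrite mulr_sumr; apply: eq_bigr => j' _; rewrite mulrA.
apply: (@le_trans _ _ (\sum_i' sqn (w ^~ i'))).
  by apply: ler_sum => i' _; exact: cM.
rewrite /sqn exchange_big /=.
apply: (@le_trans _ _ (\sum_j sqn (fun j' => v (j, j')))).
  by apply: ler_sum => j _; exact: (cN (fun j' => v (j, j'))).
rewrite /sqn pair_bigA /= le_eqVlt; apply/orP; left; apply/eqP.
by apply: eq_bigr => -[].
Qed.

Definition dsum (I J I' J' : finType) (M : I -> J -> K) (N : I' -> J' -> K)
    (p : I + I') (q : J + J') : K :=
  match p, q with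
  | inl i, inl j => M i j
  | inr i, inr j => N i j
  | _, _ => 0
  end.

Lemma contr_dsum (I J I' J' : finType) (M : I -> J -> K) (N : I' -> J' -> K) :
  contr M -> contr N -> contr (dsum M N).
Proof.
move=> cM cN v; rewrite !sqn_sum; apply: lerD.
  apply: le_trans (cM _); rewrite le_eqVlt; apply/orP; left; apply/eqP.
  congr sqn; apply/funext => i; rewrite big_sumType /=.
  by rewrite [X in _ + X]big1 ?addr0 // => j _; rewrite mul0r.
apply: le_trans (cN _); rewrite le_eqVlt; apply/orP; left; apply/eqP.
congr sqn; apply/funext => i; rewrite big_sumType /=.
by rewrite big1 ?add0r // => j _; rewrite mul0r.
Qed.

Lemma contr_scalar (I : finType) (c : K) : cabs c <= 1 ->
  contr (fun i j : I => c * (i == j)%:R).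
Proof.
move=> c1 v.
have -> : (fun i => \sum_j c * (i == j)%:R * v j) = (fun i => c * v i).
  apply/funext => i; rewrite (bigD1 i) //= eqxx mulr1 big1 ?addr0 // => j ji.
  by rewrite eq_sym (negbTE ji) mulr0 mul0r.
by rewrite sqnZ ler_piMl ?sqn_ge0 // expr_le1 ?cabs_ge0.
Qed.

(** Cauchy-Schwarz in the plane, obtained from Lagrange's identity. *)
Lemma sqr_comb (a b x y : R) : a ^+ 2 + b ^+ 2 <= 1 ->
  (a * x + b * y) ^+ 2 <= x ^+ 2 + y ^+ 2.
Proof.
move=> ab; rewrite -subr_ge0.
have -> : x ^+ 2 + y ^+ 2 - (a * x + b * y) ^+ 2 =
  (b * x - a * y) ^+ 2 + (1 - (a ^+ 2 + b ^+ 2)) * (x ^+ 2 + y ^+ 2) by ring.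
by rewrite addr_ge0 ?sqr_ge0 // mulr_ge0 ?subr_ge0 // addr_ge0 ?sqr_ge0.
Qed.

(** The block row (a M, b N). Multiplied by the column with blocks a and b it gives a^2 M + b^2 N,
    which is how sums are produced in [hball_add]. *)
Definition wrow (a b : R) (I J : finType) (M : I -> K) (N : J -> K)
    (q : I + J) : K :=
  match q with inl i => rC a * M i | inr j => rC b * N j end.

Lemma contr_wrow (a b : R) (I J : finType) (M : I -> K) (N : J -> K) :
  a ^+ 2 + b ^+ 2 <= 1 -> contr (fun _ : unit => M) -> contr (fun _ : unit => N) ->
  contr (fun _ : unit => wrow a b M N).
Proof.
move=> ab cM cN v; rewrite sqn_sum; apply: le_trans (lerD (cM _) (cN _)).
rewrite !sqn_unit big_sumType /=.
under eq_bigr do rewrite -mulrA; rewrite -mulr_sumr.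
under [X in _ + X]eq_bigr do rewrite -mulrA; rewrite -mulr_sumr.
set x := \sum_i _; set y := \sum_j _.
apply: (@le_trans _ _ ((`|a| * cabs x + `|b| * cabs y) ^+ 2)).
  rewrite lerXn2r ?nnegrE ?cabs_ge0 ?addr_ge0 ?mulr_ge0 ?cabs_ge0 //.
  by apply: le_trans (cabsD _ _) _; rewrite !cabsM !cabs_rC.
by apply: sqr_comb; rewrite !real_normK ?num_real.
Qed.

Lemma contr_wcol (a b : R) : a ^+ 2 + b ^+ 2 <= 1 ->
  contr (fun (p : unit + unit) (_ : unit) => if p is inl _ then rC a else rC b).
Proof.
move=> ab v; rewrite sqn_sum !sqn_unit !(big_pred1 tt); try by case.
rewrite !cabsM !cabs_rC !exprMn !real_normK ?num_real // -mulrDl.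
by rewrite ler_piMl // sqr_ge0.
Qed.

(** Jensen's inequality for the square: the difference of the two sides is the variance of [t] for
    the weights [h]. *)
Lemma sqr_mean (I : finType) (h t : I -> R) : (forall i, 0 <= h i) ->
  \sum_i h i = 1 -> (\sum_i h i * t i) ^+ 2 <= \sum_i h i * t i ^+ 2.
Proof.
move=> h0 h1; set T := \sum_i h i * t i.
have : 0 <= \sum_i h i * (t i - T) ^+ 2.
  by apply: sumr_ge0 => i _; rewrite mulr_ge0 ?sqr_ge0.
have -> : \sum_i h i * (t i - T) ^+ 2 = \sum_i h i * t i ^+ 2 - T ^+ 2.
  under eq_bigr => i _.
    have -> : h i * (t i - T) ^+ 2 =
      h i * t i ^+ 2 + (h i * t i * (- 2 * T) + h i * T ^+ 2) by ring.
  over.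
  by rewrite !big_split /= -!mulr_suml h1 -/T; ring.
by rewrite subr_ge0.
Qed.

(** Convexity of the squared norm, by [sqr_mean] in each coordinate. This is why averaging over a
    partition of unity does not increase the norm of a factorization. *)
Lemma contr_mean (S I J : finType) (h : S -> R) (M : S -> I -> J -> K) :
  (forall s, 0 <= h s) -> \sum_s h s = 1 -> (forall s, contr (M s)) ->
  contr (fun i j => \sum_s rC (h s) * M s i j).
Proof.
move=> h0 h1 cM v.
apply: (@le_trans _ _ (\sum_s h s * sqn (fun i => \sum_j M s i j * v j))).
  rewrite /sqn; under [leRHS]eq_bigr do rewrite mulr_sumr.
  rewrite exchange_big /=; apply: ler_sum => i _.
  apply: le_trans (sqr_mean _ h0 h1).
  rewrite lerXn2r ?nnegrE ?cabs_ge0 ?sumr_ge0 //.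
    by move=> s _; rewrite mulr_ge0 ?cabs_ge0.
  under eq_bigr do rewrite mulr_suml.
  rewrite exchange_big /=; apply: le_trans (cabs_sum _) _.
  apply: ler_sum => s _; under eq_bigr do rewrite -mulrA.
  by rewrite -mulr_sumr cabsM cabs_rC_ge0.
apply: (@le_trans _ _ (\sum_s h s * sqn v)).
  by apply: ler_sum => s _; rewrite ler_wpM2l //; exact: cM.
by rewrite -mulr_suml h1 mul1r.
Qed.

End Contractions.

(** * Products of contractive matrix-valued functions *)

Section Chains.
Variables (R : realType) (G : topologicalType).
Local Notation K := (Cplx R).

Lemma continuous_csum (I : finType) (F : I -> G -> K) :
  (forall i, continuous (F i)) -> continuous (fun x => \sum_i F i x).
Proof.
move=> cF; apply: (@continuous_big _ _ +%R) => [|i _]; last exact: cF.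
exact: add_continuous.
Qed.

Lemma continuous_cmul (f g : G -> K) :
  continuous f -> continuous g -> continuous (fun x => f x * g x).
Proof. by move=> cf cg x; apply: cvgM; [exact: cf|exact: cg]. Qed.

Lemma continuous_cscale (c : K) (f : G -> K) :
  continuous f -> continuous (fun x => c * f x).
Proof.
move=> cf; apply: (@continuous_cmul (fun=> c) f _ cf).
exact: (@cst_continuous G K c).
Qed.

(** Normalised factorizations: f y = l a_0(y 0) ... a_(m-1)(y (m-1)), with a constant contractive
    row l and continuous, pointwise contractive matrices a_k. The intermediate index types are
    existentially quantified, so that each construction may choose its own. *)
Fixpoint cchain (m : nat) (I : finType) (f : (nat -> G) -> I -> K) : Prop :=
  match m with
  | 0 => exists l : I -> K, contr (fun _ : unit => l) /\ forall y, f y = l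
  | m'.+1 => exists (J : finType) (g : (nat -> G) -> J -> K)
      (a : G -> J -> I -> K),
      [/\ cchain m' g, forall j i, continuous (fun x => a x j i),
        forall x, contr (a x)
      & forall y i, f y i = \sum_j g y j * a (y m') j i]
  end.

(** The constant contraction is absorbed into the last matrix, or into the initial row when there is
    no variable. *)
Lemma cchain_mulr m (I J : finType) (f : (nat -> G) -> I -> K)
    (c : I -> J -> K) : cchain m f -> contr c ->
  cchain m (fun y j => \sum_i f y i * c i j).
Proof.
case: m => [[l [cl fl]]|m [L [g [a [cg ca aa fE]]]]] cc.
  exists (fun j => \sum_i l i * c i j); split; first exact: (contr_mul cl cc).
  by move=> y; rewrite fl.
exists L, g, (fun x j k => \sum_i a x j i * c i k); split => //.
- move=> j k; apply: continuous_csum => i.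
  apply: (@continuous_cmul (fun x => a x j i) (fun=> c i k)) => //.
  exact: (@cst_continuous G K (c i k)).
- by move=> x; apply: contr_mul.
- move=> y k; under eq_bigr do rewrite fE mulr_suml.
  rewrite exchange_big /=; apply: eq_bigr => j _; rewrite mulr_sumr.
  by apply: eq_bigr => i _; rewrite mulrA.
Qed.

(** By the mixed product rule, Kronecker products taken stage by stage multiply to the Kronecker
    product of the two rows. This is the source of submultiplicativity. *)
Lemma cchain_tens m (I J : finType) (f : (nat -> G) -> I -> K)
    (g : (nat -> G) -> J -> K) : cchain m f -> cchain m g ->
  cchain m (fun y (p : I * J) => f y p.1 * g y p.2).
Proof.
elim: m I J f g => [|m IH] I J f g.
  move=> [l [cl fl]] [k [ck gk]]; exists (fun p => l p.1 * k p.2); split.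
    (* The tensor product of two rows has row index type [unit * unit]; this 1 by 1 matrix brings it
       back to [unit]. *)
    have c1 : contr (fun (_ : unit) (p : unit * unit) => 1 : K).
      move=> v; rewrite sqn_unit /sqn !(big_pred1 (tt, tt)) ?mul1r //;
        by move=> [[] []].
    have := contr_mul c1 (contr_tens cl ck).
    congr contr; apply/funext => -[]; apply/funext => p.
    by rewrite (big_pred1 (tt, tt)) ?mul1r // => -[[] []].
  by move=> y; rewrite fl gk.
move=> [L [f' [a [cf' ca aa fE]]]] [L' [g' [b [cg' cb bb gE]]]].
exists (L * L')%type, (fun y p => f' y p.1 * g' y p.2),
  (fun x p q => a x p.1 q.1 * b x p.2 q.2); split.
- exact: IH.
- by move=> p q; apply: continuous_cmul.
- by move=> x; apply: contr_tens.
- move=> y [i j] /=; rewrite fE gE big_distrlr /= pair_bigA /=.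
  by apply: eq_bigr => p _; rewrite mulrACA.
Qed.

(** The weights appear in the constant row only; every later stage is a block diagonal sum and
    carries the two blocks along separately. *)
Lemma cchain_wrow m (a b : R) (I J : finType) (f : (nat -> G) -> I -> K)
    (g : (nat -> G) -> J -> K) : a ^+ 2 + b ^+ 2 <= 1 ->
  cchain m f -> cchain m g -> cchain m (fun y => wrow a b (f y) (g y)).
Proof.
move=> ab; elim: m I J f g => [|m IH] I J f g.
  move=> [l [cl fl]] [k [ck gk]]; exists (wrow a b l k); split.
    exact: contr_wrow.
  by move=> y; rewrite fl gk.
move=> [L [f' [c [cf' cc kc fE]]]] [L' [g' [d [cg' cd kd gE]]]].
exists (L + L')%type, (fun y => wrow a b (f' y) (g' y)),
  (fun x => dsum (c x) (d x)); split.
- exact: IH.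
- by move=> [j|j] [i|i] //=; try exact: cst_continuous.
- by move=> x; apply: contr_dsum.
- move=> y [i|i] /=; rewrite big_sumType /=.
    rewrite fE mulr_sumr [X in _ = _ + X]big1 ?addr0; last by move=> j _; rewrite mulr0.
    by apply: eq_bigr => j _; rewrite mulrA.
  rewrite gE mulr_sumr [X in _ = X + _]big1 ?add0r; last by move=> j _; rewrite mulr0.
  by apply: eq_bigr => j _; rewrite mulrA.
Qed.

Lemma cchain_contr m (I : finType) (f : (nat -> G) -> I -> K) (y : nat -> G) :
  cchain m f -> contr (fun _ : unit => f y).
Proof.
elim: m I f => [|m IH] I f; first by move=> [l [cl fl]]; rewrite fl.
move=> [L [g [a [cg ca aa fE]]]].
rewrite (_ : f y = fun i => \sum_j g y j * a (y m) j i).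
  exact: contr_mul (IH _ _ cg) (aa (y m)).
by apply/funext => i; exact: fE.
Qed.

Lemma cchain_dep m (I : finType) (f : (nat -> G) -> I -> K) (y z : nat -> G) :
  cchain m f -> (forall k, (k < m)%N -> y k = z k) -> f y = f z.
Proof.
elim: m I f => [|m IH] I f; first by move=> [l [cl fl]]; rewrite !fl.
move=> [L [g [a [cg ca aa fE]]]] yz; apply/funext => i; rewrite !fE.
rewrite (IH _ _ cg) => [|k km]; first by rewrite yz.
by apply: yz; exact: ltnW.
Qed.

Lemma cchain_ext m (I : finType) (f g : (nat -> G) -> I -> K) :
  (forall y i, f y i = g y i) -> cchain m f -> cchain m g.
Proof.
move=> fg; suff -> : f = g by [].
by apply/funext => y; apply/funext => i.
Qed.

(* hball m c is the ball of radius c of the Haagerup norm in m variables; a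
   function of m variables is a function of the sequences y : nat -> G which
   depends on y 0, ..., y (m-1) only. *)
Definition hball (m : nat) (c : R) (F : (nat -> G) -> K) : Prop :=
  0 <= c /\ exists f : (nat -> G) -> unit -> K,
    cchain m f /\ forall y, F y = rC c * f y tt.

Lemma hball_ext m c (F F' : (nat -> G) -> K) :
  (forall y, F y = F' y) -> hball m c F -> hball m c F'.
Proof. by move=> FF'; suff -> : F = F' by []; apply/funext. Qed.

Lemma hball_dep m c F (y z : nat -> G) :
  hball m c F -> (forall k, (k < m)%N -> y k = z k) -> F y = F z.
Proof. by move=> [_ [f [cf FE]]] yz; rewrite !FE (cchain_dep cf yz). Qed.

Lemma hball_bound m c F (y : nat -> G) : hball m c F -> cabs (F y) <= c.
Proof.
move=> [c0 [f [cf ->]]]; rewrite cabsM cabs_rC_ge0 // ler_piMr //.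
have := cchain_contr y cf (fun=> 1).
rewrite !sqn_unit (big_pred1 tt); last by case.
by rewrite mulr1 cabs1 !expr1n expr_le1 ?cabs_ge0.
Qed.

Lemma hball_scale m c F (z : K) :
  hball m c F -> hball m (cabs z * c) (fun y => z * F y).
Proof.
move=> [c0 [f [cf FE]]]; split; first by rewrite mulr_ge0 ?cabs_ge0.
(* The modulus of [z] goes into the radius and its phase z / |z| into the chain; for z = 0 the
   quotient is 0, still of modulus at most one. *)
exists (fun y i => \sum_j f y j * (z / rC (cabs z) * (j == i)%:R)); split.
  apply: cchain_mulr => //; apply: contr_scalar.
  rewrite cabsM cabsV cabs_rC_ge0 ?cabs_ge0 //.
  have [->|z0] := eqVneq (cabs z) 0; first by rewrite mul0r.
  by rewrite divff.
move=> y; rewrite (big_pred1 tt); last by case.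
rewrite FE eqxx mulr1 rCM.
have [z0|z0] := eqVneq z 0; first by rewrite z0 cabs0 !mul0r.
have : rC (cabs z) != 0.
  by apply: contra_neq z0 => /(@rC_inj R (cabs z) 0) /cabs_eq0.
by move=> h; field.
Qed.

(** The chain is rescaled by c / c', which is at most one; when c' = 0 both radii vanish. *)
Lemma hball_le m c c' F : c <= c' -> hball m c F -> hball m c' F.
Proof.
move=> cc' [c0 [f [cf FE]]]; split; first exact: le_trans cc'.
have [c'0|c'0] := eqVneq c' 0.
  have c00 : c = 0 by apply/eqP; rewrite eq_le c0 -c'0 cc'.
  by exists f; split => // y; rewrite FE c00 c'0.
exists (fun y i => \sum_j f y j * (rC (c / c') * (j == i)%:R)); split.
  apply: cchain_mulr => //; apply: contr_scalar.
  have c'p : 0 < c' by rewrite lt_def c'0 (le_trans c0).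
  by rewrite cabs_rC_ge0 ?divr_ge0 ?(ltW c'p) // ler_pdivrMr // mul1r.
move=> y; rewrite (big_pred1 tt); last by case.
rewrite FE eqxx mulr1 [_ * rC (c / c')]mulrC mulrA -rCM.
by rewrite mulrCA divff // mulr1.
Qed.

Lemma hball_add m c c' F F' : hball m c F -> hball m c' F' ->
  hball m (c + c') (fun y => F y + F' y).
Proof.
move=> [c0 [f [cf FE]]] [c'0 [f' [cf' FE']]]; split; first exact: addr_ge0.
have [s0|s0] := eqVneq (c + c') 0.
  exists f; split => // y; rewrite FE FE' s0.
  have -> : c = 0 by lra.
  have -> : c' = 0 by lra.
  by rewrite !mul0r addr0.
have sp : 0 < c + c' by rewrite lt_def s0 addr_ge0.
(* With these weights the row (a f, b f') times the column (a, b) equals (c f + c' f') / (c + c'),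
   and a^2 + b^2 = 1 keeps both factors contractive. *)
pose a := Num.sqrt (c / (c + c')); pose b := Num.sqrt (c' / (c + c')).
have a2 : a * a = c / (c + c') by rewrite -expr2 sqr_sqrtr // divr_ge0 ?(ltW sp).
have b2 : b * b = c' / (c + c') by rewrite -expr2 sqr_sqrtr // divr_ge0 ?(ltW sp).
have ab : a ^+ 2 + b ^+ 2 <= 1 by rewrite !expr2 a2 b2 -mulrDl divff.
exists (fun y i => \sum_p wrow a b (f y) (f' y) p *
  (if p is inl _ then rC a else rC b)); split.
  by apply: (cchain_mulr (cchain_wrow ab cf cf')); exact: contr_wcol.
move=> y; rewrite big_sumType /= !(big_pred1 tt); try by case.
have ca : rC c = rC (c + c') * (rC a * rC a).
  by rewrite -!rCM a2 mulrCA divff // mulr1.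
have cb : rC c' = rC (c + c') * (rC b * rC b).
  by rewrite -!rCM b2 mulrCA divff // mulr1.
by rewrite FE FE' {1}ca {1}cb; ring.
Qed.

Lemma hball_mul m c c' F F' : hball m c F -> hball m c' F' ->
  hball m (c * c') (fun y => F y * F' y).
Proof.
move=> [c0 [f [cf FE]]] [c'0 [f' [cf' FE']]]; split; first exact: mulr_ge0.
exists (fun y i => \sum_p (f y p.1 * f' y p.2) * 1); split.
  apply: (@cchain_mulr m (unit * unit)%type unit _ (fun _ _ => 1)).
    exact: cchain_tens.
  move=> v; rewrite sqn_unit /sqn (big_pred1 (tt, tt)); last by case => [[] []].
  by rewrite (big_pred1 tt) ?mul1r //; case.
move=> y; rewrite (big_pred1 (tt, tt)); last by case => [[] []].
by rewrite FE FE' rCM mulr1 mulrACA.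
Qed.

Lemma hball_zero m : hball m 0 (fun _ => 0).
Proof.
(* Radius 0 makes the function vanish whatever the chain, so it suffices to exhibit one chain. *)
split => //; suff: exists f : (nat -> G) -> unit -> K, cchain m f.
  by move=> [f cf]; exists f; split => // y; rewrite mul0r.
have c0 (I J : finType) : contr (fun (_ : I) (_ : J) => 0 : K).
  move=> v; rewrite {1}/sqn big1 ?sqn_ge0 // => i _.
  by rewrite big1 ?cabs0 ?expr0n // => j _; rewrite mul0r.
elim: m => [|m [f cf]]; first by exists (fun _ _ => 0), (fun=> 0); split.
exists (fun _ _ => 0), unit, f, (fun _ _ _ => 0); split => //.
  by move=> j i; exact: cst_continuous.
by move=> y i; rewrite big1 // => j _; rewrite mulr0.
Qed.

Lemma hball_sum m (I : finType) (c : I -> R) (F : I -> (nat -> G) -> K) :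
  (forall i, hball m (c i) (F i)) -> hball m (\sum_i c i) (fun y => \sum_i F i y).
Proof.
move=> hF.
suff: hball m (\sum_i c i) (\sum_i F i).
  by apply: hball_ext => y; rewrite fct_sumE.
elim/big_ind2: _ => [|x f y g hf hg|//]; first exact: hball_zero.
exact: hball_add.
Qed.

(** Elementary tensors are built one variable at a time: [phi] divided by its bound is appended as a
    1 by 1 matrix. *)
Lemma hball_step m c b F (phi : G -> K) : hball m c F -> continuous phi ->
  (forall x, cabs (phi x) <= b) -> 0 <= b ->
  hball m.+1 (c * b) (fun y => F y * phi (y m)).
Proof.
move=> [c0 [f [cf FE]]] cphi pb b0; split; first exact: mulr_ge0.
exists (fun y _ => f y tt * (rC b^-1 * phi (y m))); split.
  exists unit, f, (fun x _ _ => rC b^-1 * phi x); split; first exact: cf.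
  - by move=> _ _; exact: continuous_cscale.
  - move=> x v; rewrite !sqn_unit (big_pred1 tt); last by case.
    rewrite cabsM exprMn ler_piMl ?sqr_ge0 // expr_le1 ?cabs_ge0 //.
    rewrite cabsM cabs_rC_ge0 ?invr_ge0 //.
    have [->|bn0] := eqVneq b 0; first by rewrite invr0 mul0r.
    by rewrite mulrC ler_pdivrMr ?mul1r // lt_def bn0.
  - by move=> y []; rewrite (big_pred1 tt) //; case.
move=> y; rewrite FE rCM rCV.
have [b00|bn0] := eqVneq b 0.
  have -> : phi (y m) = 0.
    by apply/cabs_eq0/eqP; rewrite eq_le cabs_ge0 -b00 pb.
  by rewrite !mulr0.
have : rC b != 0 by apply: contra_neq bn0 => /(@rC_inj R b 0).
by move=> h; field.
Qed.

Lemma hball_one m : hball m 1 (fun _ : nat -> G => 1 : K).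
Proof.
elim: m => [|m IH].
  split => //; exists (fun _ _ => 1); split; last by move=> y; rewrite mulr1.
  exists (fun=> 1); split => // v.
  by rewrite !sqn_unit (big_pred1 tt) ?mul1r //; case.
have c1 (x : G) : cabs (1 : K) <= 1 by rewrite cabs1.
have := hball_step IH (@cst_continuous G K 1) c1 ler01.
move=> h; apply: hball_ext (hball_le _ h); last by rewrite mulr1.
by move=> y; rewrite mulr1.
Qed.

End Chains.

(** * Comparison with the Haagerup norm *)

Section ContinuousBounds.
Variables (R : realType) (G : topologicalType).
Local Notation K := (Cplx R).

Lemma cabs_dist (z w : K) : `|cabs z - cabs w| <= cabs (z - w).
Proof.
have h (x y : K) : cabs x <= cabs (x - y) + cabs y.
  by rewrite -{1}(subrK y x) cabsD.
by rewrite ler_distl lerBlDr addrC (cabsB z) h /= [leRHS]addrC -cabsB h.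
Qed.

Lemma continuous_cabs (f : G -> K) :
  continuous f -> continuous (fun x => cabs (f x)).
Proof.
move=> cf x; apply/cvgrPdist_lt => e e0.
have /cvgrPdist_lt/(_ (rC e)) := cf x.
rewrite /rC ltcR => /(_ e0); apply: filterS => y.
rewrite cabs_norm /rC ltcR; apply: le_lt_trans.
exact: cabs_dist.
Qed.

Lemma compact_cabs_bounded (f : G -> K) : compact [set: G] -> continuous f ->
  exists2 b : R, 0 <= b & forall x, cabs (f x) <= b.
Proof.
move=> cG cf.
have := @continuous_compact _ _ (fun x => cabs (f x)) [set: G] _ cG.
move=> /(_ _)/compact_bounded [].
  by apply: continuous_subspaceT; exact: continuous_cabs.
(* Every number above [M] is a bound, hence M + 1; the maximum with 0 keeps it nonnegative also when
   [G] is empty. *)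
move=> M [_ HM]; exists (Num.max 0 (M + 1)); first by rewrite le_max lexx.
move=> x; rewrite le_max; apply/orP; right.
have /= := HM (M + 1) _ (cabs (f x)).
by rewrite ger0_norm ?cabs_ge0 //; apply; [rewrite ltrDl|exists x].
Qed.

End ContinuousBounds.

(** * Operator norms of matrices and of matrix-valued functions *)

Section MatrixNorms.
Variables (R : realType) (G : topologicalType).
Local Notation K := (Cplx R).

(** The supremum of the empty set is 0 by convention, whence the condition on the sign of [c]. *)
Lemma sup_le_bound (S : set R) c : 0 <= c -> (forall x, S x -> x <= c) -> sup S <= c.
Proof.
move=> c0 Sc; have [->|S0] := eqVneq S set0; first by rewrite sup0.
by apply: ge_sup => //; apply/set0P.
Qed.

Lemma sup_ge0 (S : set R) : (forall x, S x -> 0 <= x) -> 0 <= sup S.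
Proof.
move=> S0; have [hS|hS] := pselect (has_sup S); last by rewrite sup_out.
have [[x Sx] _] := hS; apply: le_trans (S0 _ Sx) _.
exact: ub_le_sup hS.2 _ Sx.
Qed.

Lemma vnorm2_sqr p (v : 'cV[K]_p) : vnorm2 v ^+ 2 = sqn (fun i => v i 0).
Proof. by rewrite sqr_sqrtr // sqn_ge0. Qed.

Lemma vnorm2_ge0 p (v : 'cV[K]_p) : 0 <= vnorm2 v.
Proof. exact: sqrtr_ge0. Qed.

Lemma vnorm2Z p c (v : 'cV[K]_p) : vnorm2 (c *: v) = cabs c * vnorm2 v.
Proof.
apply/eqP; rewrite -(@eqrXn2 _ 2) ?mulr_ge0 ?cabs_ge0 ?vnorm2_ge0 //.
rewrite exprMn !vnorm2_sqr -sqnZ; apply/eqP; congr sqn.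
by apply/funext => i; rewrite mxE.
Qed.

Lemma cabs_le_vnorm2 p (v : 'cV[K]_p) i : cabs (v i 0) <= vnorm2 v.
Proof.
rewrite -ler_sqr ?nnegrE ?cabs_ge0 ?vnorm2_ge0 // vnorm2_sqr.
by rewrite /sqn (bigD1 i) //= lerDl sumr_ge0 // => j _; rewrite sqr_ge0.
Qed.

Lemma vnorm2_le_sum p (v : 'cV[K]_p) : vnorm2 v <= \sum_i cabs (v i 0).
Proof.
have s0 : 0 <= \sum_i cabs (v i 0) by apply: sumr_ge0 => i _; rewrite cabs_ge0.
rewrite -ler_sqr ?nnegrE ?vnorm2_ge0 // vnorm2_sqr.
rewrite expr2 mulr_suml; apply: ler_sum => i _.
rewrite expr2 ler_wpM2l ?cabs_ge0 // (bigD1 i) //= lerDl.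
by apply: sumr_ge0 => j _; rewrite cabs_ge0.
Qed.

(** A crude bound whose purpose is finiteness: it shows that the supremum in [opnorm] runs over a
    bounded set and is therefore a genuine upper bound. *)
Lemma vnorm2_mul_le p q (M : 'M[K]_(p, q)) (v : 'cV[K]_q) :
  vnorm2 (M *m v) <= (\sum_i \sum_j cabs (M i j)) * vnorm2 v.
Proof.
apply: le_trans (vnorm2_le_sum _) _; rewrite mulr_suml; apply: ler_sum => i _.
rewrite mxE mulr_suml; apply: le_trans (cabs_sum _) _; apply: ler_sum => j _.
by rewrite cabsM ler_wpM2l ?cabs_ge0 // cabs_le_vnorm2.
Qed.

Lemma opnorm_ge0 p q (M : 'M[K]_(p, q)) : 0 <= opnorm M.
Proof. by apply: sup_ge0 => x [v _ <-]; exact: vnorm2_ge0. Qed.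

Lemma opnorm_le p q (M : 'M[K]_(p, q)) c : 0 <= c ->
  (forall v : 'cV[K]_q, vnorm2 (M *m v) <= c * vnorm2 v) -> opnorm M <= c.
Proof.
move=> c0 Mc; apply: sup_le_bound => // x [v /= v1 <-].
by apply: le_trans (Mc v) _; rewrite ler_piMr.
Qed.

Lemma opnormP p q (M : 'M[K]_(p, q)) (v : 'cV[K]_q) :
  vnorm2 (M *m v) <= opnorm M * vnorm2 v.
Proof.
set B := \sum_i \sum_j cabs (M i j).
have B0 : 0 <= B by do 2!apply: sumr_ge0 => ? _; rewrite cabs_ge0.
(* A vector of norm zero cannot be normalised; the crude bound already gives its image norm zero. *)
have [v0|v0] := eqVneq (vnorm2 v) 0.
  by have := vnorm2_mul_le M v; rewrite v0 !mulr0.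
have vp : 0 < vnorm2 v by rewrite lt_def v0 vnorm2_ge0.
rewrite -ler_pdivrMr // mulrC -(cabs_rC_ge0 (x := (vnorm2 v)^-1)); last first.
  by rewrite invr_ge0 ltW.
rewrite -vnorm2Z scalemxAr; apply: ub_le_sup.
  exists B => x [w /= w1 <-]; apply: le_trans (vnorm2_mul_le _ _) _.
  by rewrite ler_piMr.
exists (rC (vnorm2 v)^-1 *: v) => //=.
by rewrite vnorm2Z cabs_rC_ge0 ?invr_ge0 ?(ltW vp) // mulVf.
Qed.

Lemma mxC_norm_ge0 p q (a : G -> 'M[K]_(p, q)) : 0 <= mxC_norm a.
Proof. by apply: sup_ge0 => x [y _ <-]; exact: opnorm_ge0. Qed.

Lemma mxC_norm_le p q (a : G -> 'M[K]_(p, q)) c : 0 <= c ->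
  (forall x (v : 'cV[K]_q), vnorm2 (a x *m v) <= c * vnorm2 v) ->
  mxC_norm a <= c.
Proof.
by move=> c0 ac; apply: sup_le_bound => // x [y _ <-]; exact: opnorm_le.
Qed.

(** Compactness bounds each entry uniformly, hence all pointwise operator norms, so that the
    supremum in [mxC_norm] is an upper bound. *)
Lemma mxC_normP p q (a : G -> 'M[K]_(p, q)) x (v : 'cV[K]_q) :
  compact [set: G] -> mx_continuous a ->
  vnorm2 (a x *m v) <= mxC_norm a * vnorm2 v.
Proof.
move=> cG ca; apply: le_trans (opnormP _ _) _.
rewrite ler_wpM2r ?vnorm2_ge0 //; apply: ub_le_sup; last by exists x.
have /choice [b bP] (ij : 'I_p * 'I_q) :
    exists b : R, forall y, cabs (a y ij.1 ij.2) <= b.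
  by have [b _ ?] := compact_cabs_bounded cG (ca ij.1 ij.2); exists b.
exists (\sum_i \sum_j b (i, j)) => _ [y _ <-].
have le_b : \sum_i \sum_j cabs (a y i j) <= \sum_i \sum_j b (i, j).
  by do 2!apply: ler_sum => ? _; exact: (bP (_, _)).
apply: le_trans le_b; apply: opnorm_le => [|w]; last exact: vnorm2_mul_le.
by do 2!apply: sumr_ge0 => ? _; rewrite cabs_ge0.
Qed.

End MatrixNorms.

(** * Factorizations with integer dimensions versus normalised chains *)

Section Factorizations.
Variables (R : realType) (G : topologicalType).
Local Notation K := (Cplx R).

Lemma ord_size1 p (i : 'I_p) : p = 1%N -> i = 0%N :> nat.
Proof. by move=> p1; apply/eqP; rewrite -leqn0 -ltnS -[X in (_ < X)%N]p1. Qed.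

Lemma chain_scale (d : nat -> nat) (a : forall k, G -> 'M[K]_(d k, d k.+1))
    (s : nat -> K) (y : nat -> G) m :
  chain (fun k x => s k *: a k x) y m = (\prod_(k < m) s k) *: chain a y m.
Proof.
elim: m => [|m IH] /=; first by rewrite big_ord0 scale1r.
by rewrite IH big_ord_recr /= -scalemxAl -scalemxAr scalerA.
Qed.

(* Matrices of unspecified size are given by functions nat -> nat -> K, which
   avoids casts between equal dimensions. *)
Definition natmx p q (e : nat -> nat -> K) : 'M[K]_(p, q) := \matrix_(i, j) e i j.

Definition natcontr p q (e : nat -> nat -> K) :=
  contr (fun (i : 'I_p) (j : 'I_q) => e i j).

(** The single row of [chain] when d 0 = 1; the indicator of 0 is then the row of the 1 by 1
    identity. *)
Fixpoint natrow (d : nat -> nat) (E : nat -> G -> nat -> nat -> K)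
    (y : nat -> G) (m : nat) : nat -> K :=
  if m is m'.+1 then fun j => \sum_(l < d m') natrow d E y m' l * E m' (y m') l j
  else fun j => (j == 0%N)%:R.

Lemma chain_natmx d E y m (i : 'I_(d 0%N)) (j : 'I_(d m)) : d 0%N = 1%N ->
  chain (fun k x => natmx (d k) (d k.+1) (E k x)) y m i j = natrow d E y m j.
Proof.
move=> d0; have i0 := ord_size1 i d0.
elim: m j => [|m IH] j /=.
  by rewrite mxE -val_eqE /= i0 eq_sym.
by rewrite mxE; apply: eq_bigr => l _; rewrite IH mxE.
Qed.

Lemma natrow_ext d d' E E' y m : (forall k, (k < m)%N -> d k = d' k) ->
  (forall k, (k < m)%N -> E k = E' k) -> natrow d E y m = natrow d' E' y m.
Proof.
elim: m => [//|m IH] dd EE; apply/funext => j /=.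
rewrite dd // EE // IH // => k km; [apply: dd|apply: EE]; exact: ltnW.
Qed.

(** The default value 0 outside the enumerations makes the entries continuous in the parameter for
    all indices, not only those in range. *)
Definition entries (J I : finType) (M : J -> I -> K) (i j : nat) : K :=
  match (insub i : option 'I_#|J|), (insub j : option 'I_#|I|) with
  | Some i', Some j' => M (enum_val i') (enum_val j')
  | _, _ => 0
  end.

Lemma entriesE (J I : finType) (M : J -> I -> K) (i : 'I_#|J|) (j : 'I_#|I|) :
  entries M i j = M (enum_val i) (enum_val j).
Proof. by rewrite /entries !valK. Qed.

Lemma sum_enum_val (I : finType) (F : I -> K) :
  \sum_i F i = \sum_(i < #|I|) F (enum_val i).
Proof. by rewrite (reindex (@enum_val I I)) //; exact/onW_bij/enum_val_bij. Qed.

Lemma sqn_reindex (I : finType) (v : I -> K) :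
  sqn v = sqn (fun i : 'I_#|I| => v (enum_val i)).
Proof.
rewrite /sqn (reindex (@enum_val I I)) //; exact/onW_bij/enum_val_bij.
Qed.

Lemma natcontr_entries (J I : finType) (M : J -> I -> K) :
  contr M -> natcontr #|J| #|I| (entries M).
Proof.
move=> cM v; have := cM (fun i => v (enum_rank i)).
have -> : sqn (fun i => v (enum_rank i)) = sqn v.
  by rewrite sqn_reindex; congr sqn; apply/funext => i; rewrite enum_valK.
rewrite sqn_reindex; apply: le_trans; rewrite le_eqVlt; apply/orP; left; apply/eqP.
congr sqn; apply/funext => j; rewrite [RHS]sum_enum_val.
by apply: eq_bigr => i _; rewrite entriesE enum_valK.
Qed.

(** Finite index types are replaced by the integer dimensions of [factorization]. With at least one
    variable, the constant initial row can be absorbed into the first matrix. *)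
Lemma cchain_natrow m (I : finType) (f : (nat -> G) -> I -> K) :
  cchain m.+1 f -> exists d E, [/\ d 0%N = 1%N, d m.+1 = #|I|,
    forall k, (k < m.+1)%N -> forall i j, continuous (fun x => E k x i j),
    forall k, (k < m.+1)%N -> forall x, natcontr (d k) (d k.+1) (E k x)
  & forall y i, f y i = natrow d E y m.+1 (enum_rank i)].
Proof.
have continuous_entries (J L : finType) (a : G -> J -> L -> K) :
    (forall j i, continuous (fun x => a x j i)) ->
    forall i j, continuous (fun x => entries (a x) i j).
  move=> ca i j; rewrite /entries.
  case: insub => [i'|]; last exact: (@cst_continuous G K 0).
  by case: insub => [j'|]; [exact: ca|exact: (@cst_continuous G K 0)].
elim: m I f => [|m IH] I f.
  move=> [J [g [a [[l [cl gl]] ca aa fE]]]].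
  pose b x (_ : unit) i := \sum_j l j * a x j i.
  exists (fun k => if k is 0%N then 1%N else #|I|), (fun _ x => entries (b x)).
  split => //.
  - move=> k _; apply: continuous_entries => u i; apply: continuous_csum => j.
    exact: continuous_cscale.
  - case=> [|//] _ x.
    by have := natcontr_entries (contr_mul cl (aa x)); rewrite card_unit.
  - move=> y i /=; rewrite big_ord1 mul1r fE gl.
    rewrite -[X in entries _ X _](ord_size1 (enum_rank tt) card_unit).
    by rewrite entriesE !enum_rankK.
move=> [J [g [a [cg ca aa fE]]]].
have [d [E [d0 dm cE kE gE]]] := IH _ _ cg.
(* The data of the induction hypothesis are kept on the first stages and the new last matrix is
   appended at stage m + 1. *)
pose d' k := if (k <= m.+1)%N then d k else #|I|.
pose E' k x := if (k < m.+1)%N then E k x else entries (a x).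
have dd' k : (k <= m.+1)%N -> d' k = d k by rewrite /d' => ->.
have EE' k : (k < m.+1)%N -> E' k = E k.
  by move=> km; apply/funext => x; rewrite /E' km.
have d'm : d' m.+2 = #|I| by rewrite /d' ltnn.
have E'm : E' m.+1 = fun x => entries (a x).
  by apply/funext => x; rewrite /E' ltnn.
exists d', E'; split => //.
- move=> k; rewrite ltnS leq_eqVlt => /orP[/eqP ->|km].
    by rewrite E'm; exact: continuous_entries.
  by rewrite EE' //; exact: cE.
- move=> k; rewrite ltnS leq_eqVlt => /orP[/eqP ->|km] x.
    by rewrite E'm dd' // d'm dm; exact: natcontr_entries.
  by rewrite EE' // !dd' ?(ltnW km) //; exact: kE.
- move=> y i; rewrite fE.
  have -> : natrow d' E' y m.+2 =
      fun j => \sum_(l < d m.+1) natrow d E y m.+1 l * E' m.+1 (y m.+1) l j.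
    apply/funext => j; rewrite -(dd' m.+1) //.
    rewrite -(@natrow_ext d' d E' E) //; first by move=> k /ltnW/dd'.
  rewrite E'm dm [LHS]sum_enum_val; apply: eq_bigr => j _.
  by rewrite gE enum_valK entriesE enum_rankK.
Qed.

Variable n : nat.
Local Notation funs := (('I_n.+1 -> G) -> K).
Implicit Types u : funs.

(** Functions of n + 1 variables become functions of sequences, which allows inductions on the
    number of variables with no change of type. *)
Definition lift_fun (u : funs) : (nat -> G) -> K :=
  fun y => u (fun i : 'I_n.+1 => y i).

Lemma lift_funE (u : funs) (x : 'I_n.+1 -> G) :
  lift_fun u (fun k => x (inord k)) = u x.
Proof. by congr u; apply/funext => i; rewrite inord_val. Qed.

Definition factor_norms (u : funs) : set R :=
  [set r | exists d (a : forall k, G -> 'M[K]_(d k, d k.+1)),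
    factorization u a /\ r = \prod_(k < n.+1) mxC_norm (a k)].

Lemma factor_norms_ge0 u r : factor_norms u r -> 0 <= r.
Proof.
by move=> [d [a [_ ->]]]; apply: prodr_ge0 => k _; exact: mxC_norm_ge0.
Qed.

Lemma haagerup_norm_ge0 u : 0 <= haagerup_norm u.
Proof.
rewrite -[haagerup_norm u]/(inf (factor_norms u)).
have [->|/set0P S0] := eqVneq (factor_norms u) set0; first by rewrite inf0.
by apply: lb_le_inf => // r; exact: factor_norms_ge0.
Qed.

Lemma hball_factor_norms u c : hball n.+1 c (lift_fun u) ->
  exists2 r, factor_norms u r & r <= c.
Proof.
move=> [c0 [f [cf uf]]].
have [d [E [d0 dn cE kE fE]]] := cchain_natrow cf.
(* The whole radius is carried by the first matrix; the others remain contractions. *)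
pose s k : K := if k is 0%N then rC c else 1.
pose a k x := s k *: natmx (d k) (d k.+1) (E k x).
exists (\prod_(k < n.+1) mxC_norm (a k)).
  exists d, a; split => //; split => //; first by rewrite dn card_unit.
    move=> k kn i j.
    rewrite (_ : (fun x => _) = (fun x => s k * E k x i j)); last first.
      by apply/funext => x; rewrite !mxE.
    by apply: continuous_cscale; exact: cE.
  move=> x; apply/matrixP => i j.
  rewrite (chain_scale (fun k x => natmx (d k) (d k.+1) (E k x))) [LHS]mxE [RHS]mxE.
  rewrite big_ord_recl big1 // mulr1 (@chain_natmx d E) //.
  rewrite -lift_funE uf fE /=; congr (_ * _).
  rewrite (ord_size1 j) ?dn ?card_unit //.
  by rewrite (ord_size1 (enum_rank tt) card_unit).
have -> : c = \prod_(k < n.+1) cabs (s k).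
  rewrite big_ord_recl big1 => [|k _]; last exact: cabs1.
  by rewrite mulr1; exact/esym/cabs_rC_ge0.
apply: ler_prod => k _; rewrite mxC_norm_ge0 /=.
apply: mxC_norm_le => [|x v]; first exact: cabs_ge0.
rewrite -scalemxAl vnorm2Z ler_wpM2l ?cabs_ge0 //.
rewrite -ler_sqr ?nnegrE ?vnorm2_ge0 // !vnorm2_sqr.
have := kE k (ltn_ord k) x (fun i => v i 0).
apply: le_trans; rewrite le_eqVlt; apply/orP; left; apply/eqP; apply: congr1.
by apply/funext => i; rewrite mxE; apply: eq_bigr => j _; rewrite mxE.
Qed.

Lemma haagerup_norm_le u c : hball n.+1 c (lift_fun u) -> haagerup_norm u <= c.
Proof.
move=> /hball_factor_norms [r ur]; apply: le_trans; apply: ge_inf ur.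
by exists 0 => ?; exact: factor_norms_ge0.
Qed.

(** Dividing each matrix by its norm makes it pointwise contractive, by [mxC_normP], and the product
    of the norms becomes the radius. *)
Lemma factor_norms_hball u r : compact [set: G] ->
  factor_norms u r -> hball n.+1 r (lift_fun u).
Proof.
move=> cG ur; split; first exact: factor_norms_ge0 ur.
move: ur => [d [a [[d0 dn ca uE] ->]]].
pose b k := mxC_norm (a k).
pose a' k x := rC (b k)^-1 *: a k x.
(* When the norm is zero, applying [a k x] to basis vectors shows that all its entries vanish, in
   agreement with 0^-1 = 0. *)
have aE k x : (k <= n)%N -> a k x = rC (b k) *: a' k x.
  move=> kn; rewrite /a' scalerA -rCM.
  have [b0|b0] := eqVneq (b k) 0; last by rewrite divff // scale1r.
  rewrite b0 mul0r scale0r; apply/matrixP => i j; rewrite mxE.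
  have := mxC_normP x (delta_mx j 0) cG (ca k kn); rewrite -/(b k) b0 mul0r.
  move=> /(le_trans (cabs_le_vnorm2 _ i)); rewrite -colE mxE => h.
  by apply/cabs_eq0/eqP; rewrite eq_le h cabs_ge0.
have ka' k x : (k <= n)%N -> contr (fun i j => a' k x i j).
  move=> kn v.
  have := mxC_normP x (\col_j v j) cG (ca k kn); rewrite -/(b k).
  rewrite -ler_sqr ?nnegrE ?mulr_ge0 ?mxC_norm_ge0 ?vnorm2_ge0 //.
  rewrite exprMn !vnorm2_sqr => h.
  have -> : (fun i => \sum_j a' k x i j * v j) =
      fun i => rC (b k)^-1 * (a k x *m \col_j v j) i 0.
    apply/funext => i; rewrite mxE mulr_sumr; apply: eq_bigr => j _.
    by rewrite !mxE mulrA.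
  have b0 : 0 <= b k by exact: mxC_norm_ge0.
  rewrite sqnZ cabs_rC_ge0 ?invr_ge0 //.
  have vE : sqn (fun i => (\col_j v j) i 0) = sqn v.
    by congr sqn; apply/funext => i; rewrite mxE.
  rewrite vE in h.
  have [->|bn0] := eqVneq (b k) 0.
    by rewrite invr0 expr0n /= mul0r sqn_ge0.
  rewrite exprVn mulrC ler_pdivrMr ?exprn_gt0 // ?lt_def ?bn0 //.
  by rewrite mulrC.
have i0 : 'I_(d 0%N) by rewrite d0; exact: ord0.
have chP m : (m <= n.+1)%N ->
    cchain m (fun y (j : 'I_(d m)) => chain a' y m i0 j).
  elim: m => [_|m IH mn].
    exists (fun j => (i0 == j)%:R); split.
      move=> v; rewrite sqn_unit (bigD1 i0) //= eqxx mul1r big1 ?addr0.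
        by rewrite /sqn (bigD1 i0) //= lerDl sumr_ge0 // => j _; rewrite sqr_ge0.
      by move=> j ji; rewrite eq_sym (negbTE ji) mul0r.
    by move=> y; apply/funext => j; rewrite /= mxE.
  exists 'I_(d m), (fun y (j : 'I_(d m)) => chain a' y m i0 j),
    (fun x j i => a' m x j i); split.
  - exact/IH/ltnW.
  - move=> j i.
    rewrite (_ : (fun x => _) = (fun x => rC (b m)^-1 * a m x j i)); last first.
      by apply/funext => x; rewrite !mxE.
    exact/continuous_cscale/ca.
  - by move=> x; exact: ka'.
  - by move=> y i; rewrite /= mxE.
(* The last dimension is only propositionally equal to 1; it is generalised to [p] so that the
   equality can be substituted. *)
have chain1 p (h : (nat -> G) -> 'I_p -> K) (j0 : 'I_p) : p = 1%N ->
    cchain n.+1 h -> cchain n.+1 (fun y (_ : unit) => h y j0).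
  move=> p1; move: h j0; rewrite p1 => h j0 ch.
  apply: (cchain_ext _ (@cchain_mulr _ _ _ 'I_1 unit h (fun _ _ => 1) ch _)).
    by move=> y [] /=; rewrite big_ord1 mulr1; congr (h y); rewrite [j0]ord1.
  by move=> v; rewrite sqn_unit /sqn big_ord1 (big_pred1 tt) ?mul1r.
have j0 : 'I_(d n.+1) by rewrite dn; exact: ord0.
exists (fun y _ => chain a' y n.+1 i0 j0); split.
  exact: (chain1 _ (fun y j => chain a' y n.+1 i0 j)) (chP _ _).
move=> y.
have chE m z : (m <= n.+1)%N ->
    chain a z m = (\prod_(k < m) rC (b k)) *: chain a' z m.
  move=> mn; rewrite -[RHS](chain_scale a' (fun k => rC (b k))).
  elim: m mn => [//|m IH] mn /=.
  by rewrite IH ?(ltnW mn) // -aE.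
have -> : lift_fun u y = chain a (fun k => y ((inord k : 'I_n.+1))) n.+1 i0 j0.
  by rewrite (uE (fun i => y i)) mxE.
rewrite chE // mxE.
have -> : rC (\prod_(k < n.+1) mxC_norm (a k)) = \prod_(k < n.+1) rC (b k).
  exact: rmorph_prod.
congr (_ * _).
(* Up to index n the two sequences agree, and by [cchain_dep] the value of the chain depends on no
   other coordinate. *)
have zP : forall k, (k < n.+1)%N -> y (inord k : 'I_n.+1) = y k.
  by move=> k kn; rewrite inordK.
have := cchain_dep (chP _ (leqnn _)) zP.
by move=> /(congr1 (fun h : 'I_(d n.+1) -> K => h j0)).
Qed.

(** A factorization close to the infimum has norm below [c]. Its existence has to be assumed because
    the infimum of the empty set is 0 by convention. *)
Lemma haagerup_norm_lt u c : compact [set: G] -> factor_norms u !=set0 ->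
  haagerup_norm u < c -> hball n.+1 c (lift_fun u).
Proof.
move=> cG u0 uc; have : has_inf (factor_norms u).
  by split => //; exists 0 => ?; exact: factor_norms_ge0.
have e0 : 0 < c - haagerup_norm u by rewrite subr_gt0.
move=> /(inf_adherent e0) [r ur rc].
apply: (@hball_le _ _ _ r); last exact: factor_norms_hball.
by move: rc; rewrite addrC subrK => /ltW.
Qed.

End Factorizations.

(** * Approximation by averages *)

Section Partition.
Variables (R : realType) (G : topologicalType).
Local Notation K := (Cplx R).

Lemma continuous_rC (f : G -> R) : continuous f -> continuous (fun x => rC (f x)).
Proof.
move=> cf x; apply/(@cvgrPdist_lt K K) => e e0.
have [e' e'0 ee'] : exists2 e' : R, 0 < e' & rC e' = e.
  case: e e0 => a b; rewrite ltcE /= => /andP[/eqP b0 a0].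
  by exists a => //; rewrite /rC /= b0.
have /cvgrPdist_lt/(_ _ e'0) := cf x; apply: filterS => y.
rewrite cabs_norm -ee' /rC ltcR -[cabs _]/(cabs (rC (f x) - rC (f y))).
have -> : rC (f x) - rC (f y) = rC (f x - f y) by rewrite /rC rmorphB.
by rewrite cabs_rC.
Qed.

(** [T] is repacked as a space pointed at [t0] in order to apply [compact_cover]; compactness itself
    does not see the base point. *)
Lemma compact_finite_cover (T : topologicalType) (t0 : T) (A : set T) :
  compact A -> cover_compact A.
Proof.
pose P : PointedTopological.type :=
  HB.pack (Topological.sort T) (Topological.class T) (isPointed.Build T t0).
rewrite (_ : @compact T = @compact P) //.
by rewrite (@compact_cover P).
Qed.

(** The functions themselves supply the partition: D x y adds up the variations of all [phi t]
    between x and y, finitely many sets where D x < delta cover [G], and the positive parts of delta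
    - D are normalised. Wherever [h j] is nonzero, each [phi t] is within [delta] of its value at
    [s j]. *)
Lemma partition_of_unity (T : finType) (phi : T -> G -> K) (delta : R) (g0 : G) :
  compact [set: G] -> (forall t, continuous (phi t)) -> 0 < delta ->
  exists (S : finType) (s : S -> G) (h : S -> G -> R),
    [/\ forall j x, 0 <= h j x, forall x, \sum_j h j x = 1,
        forall j, continuous (fun x => rC (h j x))
      & forall t x, cabs (phi t x - \sum_j rC (h j x) * phi t (s j)) <= delta].
Proof.
move=> cG cphi d0.
pose D x y := \sum_t cabs (phi t y - phi t x).
have cD x : continuous (D x).
  move=> y; apply: (@continuous_big _ _ +%R) => [|t _].
    exact: add_continuous.
  apply: continuous_cabs => z; apply: cvgB; first exact: cphi.
  exact: (@cst_continuous G K).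
have Dxx x : D x x = 0.
  by rewrite /D big1 // => t _; rewrite subrr cabs0.
have oU x : open [set y | D x y < delta].
  have := @open_comp _ _ (D x) [set z | z < delta] (fun z _ => cD x z).
  by apply; exact: open_lt.
have := compact_finite_cover g0 cG.
move=> /(_ G setT (fun x => [set y | D x y < delta])) [||S _ SC].
- by move=> x _; exact: oU.
- by move=> y _; exists y => //=; rewrite Dxx.
(* Twice the positive part of delta - D, written so that continuity is immediate. *)
pose g (j : S) x := delta - D (val j) x + `|delta - D (val j) x|.
have g_ge0 j x : 0 <= g j x.
  by rewrite /g -[X in X + _]opprK addrC subr_ge0 -normrN ler_norm.
have gD j x : delta <= D (val j) x -> g j x = 0.
  by move=> dD; rewrite /g ler0_norm ?subrr // subr_le0.
have tot x : 0 < \sum_j g j x.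
  have [y yS yx] := SC x I.
  rewrite lt_neqAle eq_sym; apply/andP; split; last exact: sumr_ge0.
  rewrite psumr_neq0 //; apply/hasP; exists [` yS]%fset.
    by rewrite mem_index_enum.
  by rewrite /g /= gtr0_norm ?subr_gt0 // addr_gt0 ?subr_gt0.
have cg j : continuous (g j).
  move=> x; have cd : (delta - D (val j) y) @[y --> x] --> (delta - D (val j) x).
    by apply: cvgB; [exact: cvg_cst|exact: cD].
  by apply: cvgD => //; exact: cvg_norm.
exists S, (fun j => val j), (fun j x => g j x / \sum_i g i x); split.
- by move=> j x; rewrite divr_ge0 // sumr_ge0.
- by move=> x; rewrite -mulr_suml divff // gt_eqF.
- move=> j; apply: continuous_rC => x; apply: cvgM; first exact: cg.
  apply: cvgV; first by rewrite gt_eqF.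
  apply: (@continuous_big _ _ +%R) => [|i _]; [exact: add_continuous|exact: cg].
- move=> t x; set h := fun j => g j x / \sum_i g i x.
  have h1 : \sum_j h j = 1 by rewrite -mulr_suml divff // gt_eqF.
  have h0 j : 0 <= h j by rewrite divr_ge0 // sumr_ge0.
  have -> : phi t x = \sum_j rC (h j) * phi t x.
    by rewrite -mulr_suml -rC_sum h1 mul1r.
  rewrite -sumrB; apply: le_trans (cabs_sum _) _.
  rewrite -[leRHS]mul1r -h1 mulr_suml; apply: ler_sum => j _.
  rewrite -mulrBr cabsM cabs_rC_ge0 //.
  have [dD|Dd] := leP delta (D (val j) x); first by rewrite /h gD // mul0r !mul0r.
  rewrite ler_wpM2l //; apply: le_trans (ltW Dd).
  by rewrite /D (bigD1 t) //= lerDl sumr_ge0 // => i _; rewrite cabs_ge0.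
Qed.

End Partition.

(** * The averaging operator on functions of several variables *)

Section Averaging.
Variables (R : realType) (G : topologicalType).
Local Notation K := (Cplx R).
Variables (S : finType) (s : S -> G) (h : S -> G -> R).
Hypothesis h_ge0 : forall j x, 0 <= h j x.
Hypothesis h_sum : forall x, \sum_j h j x = 1.
Hypothesis h_cont : forall j, continuous (fun x => rC (h j x)).

Definition upd (y : nat -> G) (k : nat) (x : G) : nat -> G :=
  fun i => if i == k then x else y i.

(* The operator f |-> sum_j f (s j) * h j, applied in each of the first m
   variables. *)
Fixpoint avg (m : nat) (F : (nat -> G) -> K) (y : nat -> G) : K :=
  if m is m'.+1 then
    \sum_j rC (h j (y m')) * avg m' (fun z => F (upd z m' (s j))) y
  else F y.

Lemma eq_avg m F F' y : (forall z, F z = F' z) -> avg m F y = avg m F' y.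
Proof. by move=> FF; congr avg; exact/funext. Qed.

Lemma avg_sum m (I : finType) (F : I -> (nat -> G) -> K) y :
  avg m (fun z => \sum_i F i z) y = \sum_i avg m (F i) y.
Proof.
elim: m F => [//|m IH] F /=; rewrite exchange_big /=.
by apply: eq_bigr => j _; rewrite IH mulr_sumr.
Qed.

Lemma avg_mulr m (F : (nat -> G) -> K) c y :
  avg m (fun z => F z * c) y = avg m F y * c.
Proof.
elim: m F => [//|m IH] F /=; rewrite mulr_suml.
by apply: eq_bigr => j _; rewrite IH mulrA.
Qed.

Lemma avg_mull m (F : (nat -> G) -> K) c y :
  avg m (fun z => c * F z) y = c * avg m F y.
Proof. by rewrite mulrC -avg_mulr; apply: eq_avg => z; rewrite mulrC. Qed.

Lemma avg_add m (F F' : (nat -> G) -> K) y :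
  avg m (fun z => F z + F' z) y = avg m F y + avg m F' y.
Proof.
elim: m F F' => [//|m IH] F F' /=; rewrite -big_split /=.
by apply: eq_bigr => j _; rewrite IH mulrDr.
Qed.

Lemma avg_prod m (phi : nat -> G -> K) y :
  avg m (fun z => \prod_(k < m) phi k (z k)) y =
  \prod_(k < m) \sum_j rC (h j (y k)) * phi k (s j).
Proof.
elim: m => [|m IH] /=; first by rewrite !big_ord0.
rewrite big_ord_recr /= mulr_sumr; apply: eq_bigr => j _.
rewrite mulrCA -IH -avg_mulr; congr (_ * _); apply: eq_avg => z.
rewrite big_ord_recr /= {2}/upd eqxx; congr (_ * _).
by apply: eq_bigr => k _; rewrite /upd ltn_eqF.
Qed.

(** Each matrix depends on one variable only, so averaging a product averages each matrix
    separately; the averaged matrices stay contractive by [contr_mean]. *)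
Lemma cchain_avg m (I : finType) (f : (nat -> G) -> I -> K) :
  cchain m f -> cchain m (fun y i => avg m (fun z => f z i) y).
Proof.
elim: m I f => [//|m IH] I f [J [g [a [cg ca aa fE]]]].
exists J, (fun y j => avg m (fun z => g z j) y),
  (fun x j i => \sum_t rC (h t x) * a (s t) j i); split.
- exact: IH.
- move=> j i; apply: continuous_csum => t.
  apply: (@continuous_cmul _ _ (fun x => rC (h t x)) (fun=> a (s t) j i)) => //.
  exact: (@cst_continuous G K).
- by move=> x; apply: contr_mean.
- move=> y i /=; under [RHS]eq_bigr do rewrite mulr_sumr.
  rewrite exchange_big /=; apply: eq_bigr => t _.
  under [RHS]eq_bigr do rewrite mulrCA -avg_mulr.
  rewrite -mulr_sumr -avg_sum; congr (_ * _); apply: eq_avg => z.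
  rewrite fE; apply: eq_bigr => j _; rewrite {2}/upd eqxx; congr (_ * _).
  rewrite (@cchain_dep _ _ _ _ _ _ z cg) // => k km.
  by rewrite /upd ltn_eqF.
Qed.

Lemma hball_avg m c F : hball m c F -> hball m c (avg m F).
Proof.
move=> [c0 [f [cf FE]]]; split => //.
exists (fun y i => avg m (fun z => f z i) y); split; first exact: cchain_avg.
by move=> y; rewrite -avg_mull; apply: eq_avg => z; rewrite FE.
Qed.

(** The average is a sum over m-tuples of indices in [S] of elementary tensors of the [h j],
    weighted by values of [F] at the points [s j]. There are #|S|^m terms, each of norm at most [c],
    so smallness in the supremum norm becomes smallness in the Haagerup norm. *)
Lemma hball_avg_bounded m (F : (nat -> G) -> K) c (y0 : nat -> G) :
  (forall y z, (forall k, (k < m)%N -> y k = z k) -> F y = F z) ->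
  (forall y, cabs (F y) <= c) -> hball m (c * #|S|%:R ^+ m) (avg m F).
Proof.
elim: m F => [|m IH] F Fdep Fc.
  rewrite expr0 mulr1.
  apply: (@hball_le _ _ _ (cabs (F y0) * 1)); first by rewrite mulr1.
  apply: hball_ext (hball_scale (F y0) (hball_one R G 0)) => y /=.
  by rewrite mulr1; exact: Fdep.
have -> : c * #|S|%:R ^+ m.+1 = \sum_(j : S) c * #|S|%:R ^+ m * 1 :> R.
  by rewrite sumr_const mulr1 exprSr mulrA mulr_natr.
apply: (hball_sum (F := fun j y => _ * _)) => j.
apply: hball_ext (hball_step (phi := fun x => rC (h j x)) (IH _ _ _) _ _ ler01).
- by move=> y; rewrite mulrC.
- move=> y z yz; apply: Fdep => k; rewrite ltnS leq_eqVlt /upd.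
  by have [//|_ /= /yz] := eqVneq k m.
- by move=> y; exact: Fc.
- exact: h_cont.
- move=> x; rewrite cabs_rC_ge0 // -(h_sum x) (bigD1 j) //= lerDl.
  by apply: sumr_ge0 => i _; exact: h_ge0.
Qed.

End Averaging.

(** * Lower semicontinuity under uniform convergence *)

Section LowerSemicontinuity.
Variables (R : realType) (G : topologicalType).
Local Notation K := (Cplx R).

Lemma hball_prod m (phi : nat -> G -> K) (b : nat -> R) :
  (forall k, (k < m)%N -> continuous (phi k)) -> (forall k, 0 <= b k) ->
  (forall k x, (k < m)%N -> cabs (phi k x) <= b k) ->
  hball m (\prod_(k < m) b k) (fun y => \prod_(k < m) phi k (y k)).
Proof.
move=> + b0; elim: m => [|m IH] cphi phib.
  rewrite big_ord0; apply: hball_ext (hball_one R G 0) => y.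
  by rewrite big_ord0.
rewrite big_ord_recr /=.
have := hball_step (IH _ _) (cphi m _) (fun x => phib m x _) (b0 m).
move=> /(_ _ _ _ _) hs; apply: hball_ext (hs _ _ _ _) => //.
- by move=> y; rewrite big_ord_recr.
- by move=> k /ltnW; exact: cphi.
- by move=> k x /ltnW; exact: phib.
Qed.

(** Telescoping: the last factor contributes (P - Q) phi_m + Q (phi_m - psi_m), where P and Q are
    the shorter products. The condition 1 <= b absorbs the differing powers of [b] into one
    constant. *)
Lemma hball_prod_diff m (phi psi : nat -> G -> K) (b delta : R) :
  1 <= b -> 0 <= delta ->
  (forall k, (k < m)%N -> continuous (phi k)) ->
  (forall k, (k < m)%N -> continuous (psi k)) ->
  (forall k x, (k < m)%N -> cabs (phi k x) <= b) ->
  (forall k x, (k < m)%N -> cabs (psi k x) <= b) ->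
  (forall k x, (k < m)%N -> cabs (phi k x - psi k x) <= delta) ->
  hball m (m%:R * b ^+ m * delta)
    (fun y => \prod_(k < m) phi k (y k) - \prod_(k < m) psi k (y k)).
Proof.
move=> b1 d0; have b0 := le_trans ler01 b1.
elim: m => [|m IH] cphi cpsi phib psib diff.
  rewrite !mul0r; apply: hball_ext (hball_zero R G 0) => y.
  by rewrite !big_ord0 subrr.
have {}IH := IH (fun k km => cphi k (ltnW km)) (fun k km => cpsi k (ltnW km))
  (fun k x km => phib k x (ltnW km)) (fun k x km => psib k x (ltnW km))
  (fun k x km => diff k x (ltnW km)).
have h1 := hball_step IH (cphi m (ltnSn m)) (fun x => phib m x (ltnSn m)) b0.
have hpsi := hball_prod (fun k km => cpsi k (ltnW km)) (fun=> b0)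
  (fun k x km => psib k x (ltnW km)).
have cd : continuous (fun x => phi m x - psi m x).
  by move=> x; apply: cvgB; [exact: cphi|exact: cpsi].
have h2 := hball_step hpsi cd (fun x => diff m x (ltnSn m)) d0.
apply: (@hball_le _ _ _ _ _ _ _ (hball_ext _ (hball_add h1 h2))).
  rewrite prodr_const card_ord -(natr1 m) mulrDl mul1r mulrDl.
  rewrite [b ^+ m.+1]exprSr; apply: lerD.
    by rewrite le_eqVlt; apply/orP; left; apply/eqP; ring.
  by rewrite ler_wpM2r // ler_peMr // exprn_ge0.
by move=> y /=; rewrite !big_ord_recr /=; ring.
Qed.

(* Lower semicontinuity for uniform convergence, from the decomposition
   F = (F - avg F) + avg (F - F') + avg F' with F' uniformly close to F. *)
Lemma hball_lsc m (J : finType) (phi : J -> nat -> G -> K)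
    (F : (nat -> G) -> K) c (y0 : nat -> G) : compact [set: G] ->
  (forall j k, (k < m)%N -> continuous (phi j k)) ->
  (forall y, F y = \sum_j \prod_(k < m) phi j k (y k)) ->
  (forall delta : R, 0 < delta -> exists2 F', hball m c F' &
     forall y, cabs (F y - F' y) <= delta) ->
  forall e : R, 0 < e -> hball m (c + e) F.
Proof.
move=> cG cphi FE Fapp e e0.
have [b b1 phib] : exists2 b : R, 1 <= b &
    forall (t : J * 'I_m) x, cabs (phi t.1 t.2 x) <= b.
  have /choice [b bP] (t : J * 'I_m) : exists b : R, 0 <= b /\
      forall x, cabs (phi t.1 t.2 x) <= b.
    have [b b0 bP] := compact_cabs_bounded cG (cphi t.1 _ (ltn_ord t.2)).
    by exists b.
  have b0 t : 0 <= b t by case: (bP t).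
  exists (1 + \sum_t b t); first by rewrite lerDl sumr_ge0.
  move=> t x; apply: le_trans (proj2 (bP t) x) _.
  rewrite (bigD1 t) //= addrCA lerDl addr_ge0 //.
  by apply: sumr_ge0 => i _.
have b0 := le_trans ler01 b1.
(* Chosen so that F - avg F, a sum of #|J| differences estimated by [hball_prod_diff], has norm at
   most e / 2; the added 1 keeps the denominator positive. *)
pose d1 := e / 2 / (#|J|%:R * (m%:R * b ^+ m) + 1).
have B0 : 0 < #|J|%:R * (m%:R * b ^+ m) + 1 :> R.
  by rewrite ltr_wpDl // !mulr_ge0 // exprn_ge0.
have e2 : 0 < e / 2 by rewrite divr_gt0.
have d10 : 0 < d1 by rewrite divr_gt0.
have [S [s [h [h0 h1 hc hd]]]] := partition_of_unity (y0 0%N) cG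
  (fun t : J * 'I_m => cphi t.1 _ (ltn_ord t.2)) d10.
have S0 : 0 < #|S|%:R ^+ m + 1 :> R by rewrite ltr_wpDl // exprn_ge0.
(* The uniform tolerance is chosen after the partition, since the bound on avg (F - F') involves the
   size of [S]. *)
pose d2 := e / 2 / (#|S|%:R ^+ m + 1).
have d20 : 0 < d2 by rewrite divr_gt0.
have [F' hF' FF'] := Fapp d2 d20.
have Fdep y z : (forall k, (k < m)%N -> y k = z k) -> F y = F z.
  by move=> yz; rewrite !FE; apply: eq_bigr => j _; apply: eq_bigr => k _; rewrite yz.
(* The averages of the factors; by [avg_prod] their products sum to avg F. *)
pose psi j k x := \sum_t rC (h t x) * phi j k (s t).
have cpsi j k : continuous (psi j k).
  apply: continuous_csum => t.
  apply: (@continuous_cmul _ _ (fun x => rC (h t x)) (fun=> phi j k (s t))) => //.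
  exact: (@cst_continuous G K).
have psib j k x : (k < m)%N -> cabs (psi j k x) <= b.
  move=> km; apply: le_trans (cabs_sum _) _.
  rewrite -[leRHS]mul1r -(h1 x) mulr_suml; apply: ler_sum => t _.
  rewrite cabsM cabs_rC_ge0 // ler_wpM2l //.
  exact: (phib (j, Ordinal km)).
have H1 : hball m (\sum_(j : J) m%:R * b ^+ m * d1)
    (fun y => \sum_j (\prod_(k < m) phi j k (y k) - \prod_(k < m) psi j k (y k))).
  apply: (hball_sum (F := fun j y => _ - _)) => j; apply: hball_prod_diff => //.
  - exact: ltW.
  - exact: cphi.
  - by move=> k x km; exact: (phib (j, Ordinal km)).
  - by move=> k x km; exact: psib.
  - by move=> k x km; exact: (hd (j, Ordinal km)).
have H2 : hball m (d2 * #|S|%:R ^+ m) (avg s h m (fun y => F y - F' y)).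
  apply: hball_avg_bounded => // y z yz.
  by rewrite (Fdep y z) // (hball_dep hF' yz).
have H3 := hball_avg s h0 h1 hc hF'.
apply: (@hball_le _ _ _ _ _ _ _ (hball_ext _ (hball_add (hball_add H1 H2) H3))).
  rewrite addrC lerD2l [e in leRHS]splitr; apply: lerD.
    rewrite sumr_const -[leLHS]mulr_natl mulrA /d1 [leLHS]mulrCA.
    by rewrite ler_piMr ?(ltW e2) // ler_pdivrMr // mul1r lerDl.
  rewrite /d2 -mulrA ler_piMr ?(ltW e2) // mulrC ler_pdivrMr // mul1r lerDl.
  exact: ler01.
move=> y /=; rewrite sumrB -FE.
have <- : avg s h m F y = \sum_j \prod_(k < m) psi j k (y k).
  rewrite (_ : F = fun y => \sum_j \prod_(k < m) phi j k (y k)); last exact/funext.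
  by rewrite avg_sum; apply: eq_bigr => j _; rewrite avg_prod.
have -> : avg s h m (fun y => F y - F' y) y = avg s h m F y - avg s h m F' y.
  rewrite -[X in _ - X]mul1r -mulNr -avg_mull -avg_add; apply: eq_avg => z.
  by rewrite mulN1r.
by ring.
Qed.

End LowerSemicontinuity.

(** * The normed algebra of algebraic tensors *)

Section AlgebraicTensors.
Variables (R : realType) (G : topologicalType) (n : nat).
Local Notation K := (Cplx R).
Local Notation funs := (('I_n.+1 -> G) -> K).
Implicit Types u v w : funs.

Lemma alg_tensorP u : alg_tensor u <->
  exists (J : finType) (phi : J -> 'I_n.+1 -> G -> K),
    (forall j i, continuous (phi j i)) /\
    forall x, u x = \sum_j \prod_(i < n.+1) phi j i (x i).
Proof.
split=> [[r [phi [cphi ->]]]|[J [phi [cphi uE]]]]; first by exists 'I_r, phi.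
exists #|J|, (fun j => phi (enum_val j)); split => [j i|]; first exact: cphi.
by apply/funext => x; rewrite uE sum_enum_val.
Qed.

Lemma alg_tensorD u v : alg_tensor u -> alg_tensor v -> alg_tensor (u + v).
Proof.
move=> /alg_tensorP[J [phi [cphi uE]]] /alg_tensorP[L [psi [cpsi vE]]].
apply/alg_tensorP; exists (J + L)%type.
exists (fun p => match p with inl j => phi j | inr l => psi l end).
split=> [[j|l] i|x]; [exact: cphi|exact: cpsi|].
by rewrite big_sumType -uE -vE.
Qed.

Lemma alg_tensorM u v : alg_tensor u -> alg_tensor v ->
  alg_tensor (fun x => u x * v x).
Proof.
move=> /alg_tensorP[J [phi [cphi uE]]] /alg_tensorP[L [psi [cpsi vE]]].
apply/alg_tensorP; exists (J * L)%type, (fun p i x => phi p.1 i x * psi p.2 i x).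
split=> [p i|x]; first exact: continuous_cmul.
rewrite uE vE big_distrlr /= pair_bigA; apply: eq_bigr => p _.
by rewrite big_split.
Qed.

Lemma alg_tensor_cst (c : K) : alg_tensor (fun _ : 'I_n.+1 -> G => c).
Proof.
apply/alg_tensorP; exists unit, (fun _ i _ => if i == ord0 then c else 1).
split=> [_ i|x]; first exact: (@cst_continuous G K).
by rewrite (big_pred1 tt) => [|[]//]; rewrite big_ord_recl big1 // mulr1.
Qed.

Lemma alg_tensor0 : alg_tensor (0 : funs).
Proof. exact: alg_tensor_cst. Qed.

Lemma alg_tensorZ (c : K) u : alg_tensor u -> alg_tensor (c *: u).
Proof. exact: (alg_tensorM (alg_tensor_cst c)). Qed.

Lemma alg_tensorN u : alg_tensor u -> alg_tensor (- u).
Proof. by rewrite -scaleN1r; exact: alg_tensorZ. Qed.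

Lemma alg_tensorB u v : alg_tensor u -> alg_tensor v -> alg_tensor (u - v).
Proof. by move=> au av; apply/alg_tensorD/alg_tensorN. Qed.

(** Here [{ptws 'I_n.+1 -> G}] is G^(n+1) with its product topology. *)
Lemma alg_tensor_continuous u : alg_tensor u ->
  continuous (u : {ptws 'I_n.+1 -> G} -> K).
Proof.
move=> /alg_tensorP[J [phi [cphi uE]]].
rewrite (_ : u = fun x => \sum_j \prod_(i < n.+1) phi j i (x i)); last exact/funext.
apply: (@continuous_big _ _ +%R) => [|j _]; first exact: add_continuous.
apply: (@continuous_big K _ (fun a b : K => a * b)) => [|i _].
  exact: mul_continuous.
move=> x; have xi := @proj_continuous _ (fun=> G) i x.
exact: (continuous_comp xi (cphi j i _)).
Qed.

Hypothesis cG : compact [set: G].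

(** Elementary tensors factor through 1 by 1 matrices. In particular the infimum defining the
    Haagerup norm is over a nonempty set. *)
Lemma alg_tensor_hball u : alg_tensor u -> exists c, hball n.+1 c (lift_fun u).
Proof.
move=> /alg_tensorP[J [phi [cphi uE]]].
have /choice [b bP] (t : J * 'I_n.+1) : exists b : R, 0 <= b /\
    forall x, cabs (phi t.1 t.2 x) <= b.
  by have [b b0 bP] := compact_cabs_bounded cG (cphi t.1 t.2); exists b.
exists (\sum_j \prod_(k < n.+1) b (j, inord k)).
apply: hball_ext (hball_sum (F := fun j y => \prod_(k < n.+1) phi j (inord k) (y k)) _).
  move=> y; rewrite /lift_fun uE; apply: eq_bigr => j _; apply: eq_bigr => k _.
  by rewrite inord_val.
move=> j; apply: (hball_prod (phi := fun k => phi j (inord k))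
  (b := fun k => b (j, inord k))).
- by move=> k _; exact: cphi.
- by move=> k; case: (bP (j, inord k)).
- by move=> k x _; case: (bP (j, inord k)) => _; exact.
Qed.

Lemma haagerup_norm_hball u c : alg_tensor u -> haagerup_norm u < c ->
  hball n.+1 c (lift_fun u).
Proof.
move=> /alg_tensor_hball [c0 hc0]; apply: haagerup_norm_lt => //.
by have [r ur _] := hball_factor_norms hc0; exists r.
Qed.

Lemma haagerup_norm_eps u e : alg_tensor u -> 0 < e ->
  hball n.+1 (haagerup_norm u + e) (lift_fun u).
Proof. by move=> au e0; apply: haagerup_norm_hball => //; rewrite ltrDl. Qed.

Lemma haagerup_normD u v : alg_tensor u -> alg_tensor v ->
  haagerup_norm (u + v) <= haagerup_norm u + haagerup_norm v.
Proof.
move=> au av; apply/ler_addgt0Pr => e e0; have e2 : 0 < e / 2 by rewrite divr_gt0.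
apply: haagerup_norm_le.
apply: hball_le (hball_add (haagerup_norm_eps au e2) (haagerup_norm_eps av e2)).
by rewrite addrACA -splitr.
Qed.

Lemma ler_mul_eps (x a b : R) : 0 <= a -> 0 <= b ->
  (forall e, 0 < e -> x <= (a + e) * (b + e)) -> x <= a * b.
Proof.
move=> a0 b0 H; rewrite leNgt; apply/negP => abx.
(* As e <= 1, the product (a + e)(b + e) is at most a b + e (a + b + 1), which by the second bound
   stays below the midpoint of a b and x. *)
pose e := Num.min 1 ((x - a * b) / (a + b + 1) / 2).
have s0 : 0 < a + b + 1 by rewrite ltr_wpDl // addr_ge0.
have e0 : 0 < e by rewrite lt_min ltr01 !divr_gt0 // subr_gt0.
have e1 : e <= 1 by rewrite ge_min lexx.
have : e * (a + b + 1) <= (x - a * b) / 2.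
  rewrite -ler_pdivlMr // mulrAC.
  by rewrite ge_min lexx orbT.
have := H e e0.
have : e * e <= e by rewrite ler_piMr // ltW.
move=> h1 h2 h3; have : x <= a * b + (x - a * b) / 2.
  apply: le_trans h2 _; apply: le_trans (lerD (lexx (a * b)) h3).
  rewrite -subr_ge0.
  have -> : a * b + e * (a + b + 1) - (a + e) * (b + e) = e - e * e by ring.
  by rewrite subr_ge0.
lra.
Qed.

Lemma haagerup_normM u v : alg_tensor u -> alg_tensor v ->
  haagerup_norm (fun x => u x * v x) <= haagerup_norm u * haagerup_norm v.
Proof.
move=> au av; apply: ler_mul_eps => [||e e0]; try exact: haagerup_norm_ge0.
apply: haagerup_norm_le.
exact: hball_mul (haagerup_norm_eps au e0) (haagerup_norm_eps av e0).
Qed.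

Lemma haagerup_normZ_le (c : K) u : alg_tensor u ->
  haagerup_norm (c *: u) <= cabs c * haagerup_norm u.
Proof.
move=> au; apply: ler_mul_eps => [||e e0]; try exact: haagerup_norm_ge0.
  exact: cabs_ge0.
apply: haagerup_norm_le.
apply: hball_le (hball_scale c (haagerup_norm_eps au e0)).
rewrite ler_wpM2r ?lerDl ?(ltW e0) // addr_ge0 ?(ltW e0) //.
exact: haagerup_norm_ge0.
Qed.

Lemma haagerup_norm0 : haagerup_norm (0 : funs) = 0.
Proof.
apply/eqP; rewrite eq_le haagerup_norm_ge0 andbT.
by apply: haagerup_norm_le; exact: hball_zero.
Qed.

Lemma haagerup_normZ (c : K) u : alg_tensor u ->
  haagerup_norm (c *: u) = cabs c * haagerup_norm u.
Proof.
move=> au; have [->|c0] := eqVneq c 0.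
  by rewrite scale0r haagerup_norm0 cabs0 mul0r.
apply/eqP; rewrite eq_le haagerup_normZ_le //=.
have cp : 0 < cabs c.
  rewrite lt_def cabs_ge0 andbT; apply: contra_neq c0; exact: cabs_eq0.
(* The reverse inequality is the direct one for the scalar c^-1 and the tensor c u. *)
have := haagerup_normZ_le c^-1 (alg_tensorZ c au).
by rewrite scalerA mulVf // scale1r cabsV -ler_pdivlMl ?invr_gt0 // invrK.
Qed.

Lemma haagerup_normN u : alg_tensor u -> haagerup_norm (- u) = haagerup_norm u.
Proof. by move=> au; rewrite -scaleN1r haagerup_normZ // cabsN cabs1 mul1r. Qed.

Lemma haagerup_normBC u v : alg_tensor u -> alg_tensor v ->
  haagerup_norm (u - v) = haagerup_norm (v - u).
Proof. by move=> au av; rewrite -haagerup_normN ?opprB //; exact: alg_tensorB. Qed.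

(** This makes Haagerup-Cauchy sequences uniformly Cauchy and so provides their limits as
    functions. *)
Lemma cabs_le_haagerup u x : alg_tensor u -> cabs (u x) <= haagerup_norm u.
Proof.
move=> au; apply/ler_addgt0Pr => e e0.
by rewrite -(lift_funE u); apply: hball_bound; exact: haagerup_norm_eps.
Qed.

Lemma haagerup_norm_dist u v : alg_tensor u -> alg_tensor v ->
  `|haagerup_norm u - haagerup_norm v| <= haagerup_norm (u - v).
Proof.
move=> au av; have h (w w' : funs) : alg_tensor w -> alg_tensor w' ->
    haagerup_norm w <= haagerup_norm (w - w') + haagerup_norm w'.
  move=> aw aw'; rewrite -{1}(subrK w' w); apply: haagerup_normD => //.
  exact: alg_tensorB.
rewrite ler_distl lerBlDr addrC (haagerup_normBC au av) h //=.
by rewrite [leRHS]addrC haagerup_normBC // h.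
Qed.

(** Half of the margin e turns the norm bound on the approximants into membership in the ball of
    radius c + e / 2; the other half is spent in [hball_lsc]. *)
Lemma haagerup_norm_lsc (g0 : G) u c : alg_tensor u ->
  (forall delta : R, 0 < delta -> exists v, [/\ alg_tensor v,
     haagerup_norm v <= c & forall x, cabs (u x - v x) <= delta]) ->
  haagerup_norm u <= c.
Proof.
move=> /alg_tensorP[J [phi [cphi uE]]] uv.
apply/ler_addgt0Pr => e e0; apply: haagerup_norm_le.
have e2 : 0 < e / 2 by rewrite divr_gt0.
rewrite [e]splitr addrA.
apply: (@hball_lsc _ _ _ J (fun j k => phi j (inord k)) _ _ (fun=> g0)) => //.
- move=> y; rewrite /lift_fun uE; apply: eq_bigr => j _; apply: eq_bigr => k _.
  by rewrite inord_val.
- move=> delta d0; have [v [av vc vd]] := uv _ d0.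
  exists (lift_fun v); last by move=> y; exact: vd.
  by apply: haagerup_norm_hball => //; apply: le_lt_trans vc _; rewrite ltrDl.
Qed.

End AlgebraicTensors.

(** * The completion *)

Section Completion.
Variables (R : realType) (G : topologicalType) (n : nat).
Local Notation K := (Cplx R).
Local Notation funs := (('I_n.+1 -> G) -> K).
Local Notation N := (@haagerup_norm R G n).
Implicit Types (f g : funs) (u v : nat -> funs).

Lemma uniform_cvgP u f : {uniform, u @ \oo --> f} <->
  forall e : R, 0 < e -> exists k0, forall k, (k0 <= k)%N ->
    forall x, cabs (u k x - f x) <= e.
Proof.
split=> [uf e e0|H].
  pose E : set (K * K) := [set zw | ball zw.1 (rC e) zw.2].
  have entE : entourage E.
    rewrite -(@entourage_ballE K K); exists (rC e) => //=.
    by rewrite /rC ltcR.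
  have [|k0 _ ku] := uf [set h | forall x, E (f x, h x)].
    by apply/uniform_nbhs; exists E; split => // h hE x; exact: hE.
  exists k0 => k k0k x; have := ku k k0k x.
  rewrite /E /= -ball_normE /= cabs_norm /rC ltcR cabsB; exact: ltW.
move=> P /uniform_nbhs [E [entE EP]].
move: entE; rewrite -(@entourage_ballE K K) => -[r /= r0 rE].
have [e e0 er] : exists2 e : R, 0 < e & rC e = r.
  move: r0; case: r {rE} => a b; rewrite ltcE /= => /andP[/eqP b0 a0].
  by exists a => //; rewrite /rC /= b0.
have [k0 kP] := H (e / 2) (divr_gt0 e0 (ltr0Sn R 1)).
exists k0 => // k k0k; apply: EP => x _; apply: rE => /=.
rewrite -ball_normE /= cabs_norm -er /rC ltcR cabsB.
apply: le_lt_trans (kP k k0k x) _.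
by rewrite ltr_pdivrMr // ltr_pMr // ltr1n.
Qed.

Lemma cvg_realP (s : nat -> R) r : s k @[k --> \oo] --> r <->
  forall e : R, 0 < e -> exists k0, forall k, (k0 <= k)%N -> `|s k - r| <= e.
Proof.
split=> [/cvgrPdist_lt H e e0|H].
  have [k0 _ kP] := H e e0; exists k0 => k k0k.
  by rewrite distrC; apply/ltW/kP.
apply/cvgrPdist_lt => e e0.
have [k0 kP] := H (e / 2) (divr_gt0 e0 (ltr0Sn R 1)).
exists k0 => // k k0k /=; rewrite distrC; apply: le_lt_trans (kP k k0k) _.
by rewrite ltr_pdivrMr // ltr_pMr // ltr1n.
Qed.

Lemma real_cauchy_cvg (s : nat -> R) :
  (forall e : R, 0 < e -> exists k0, forall k l, (k0 <= k)%N -> (k0 <= l)%N ->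
     `|s k - s l| <= e) -> exists r : R, s k @[k --> \oo] --> r.
Proof.
move=> H; suff: cvg (s k @[k --> \oo]) by move=> /cvg_ex.
apply: R_complete; apply: cauchy_exP => e e0.
have [k0 kP] := H (e / 2) (divr_gt0 e0 (ltr0Sn R 1)).
exists (s k0); exists k0 => // k k0k; rewrite -ball_normE /=.
apply: le_lt_trans (kP _ _ (leqnn _) k0k) _.
by rewrite ltr_pdivrMr // ltr_pMr // ltr1n.
Qed.

Lemma cabs_ReIm (z : K) :
  [/\ `|complex.Re z| <= cabs z, `|complex.Im z| <= cabs z
    & cabs z <= `|complex.Re z| + `|complex.Im z|].
Proof.
case: z => a b; rewrite /cabs /= -!sqrtr_sqr; split.
- by rewrite ler_wsqrtr // lerDl sqr_ge0.
- by rewrite ler_wsqrtr // lerDr sqr_ge0.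
- rewrite !sqrtr_sqr -ler_sqr ?nnegrE ?sqrtr_ge0 ?addr_ge0 //.
  rewrite sqr_sqrtr ?addr_ge0 ?sqr_ge0 // sqrrD !real_normK ?num_real //.
  by rewrite lerD2r lerDl mulrn_wge0 // mulr_ge0.
Qed.

Lemma complex_cauchy_cvg (z : nat -> K) :
  (forall e : R, 0 < e -> exists k0, forall k l, (k0 <= k)%N -> (k0 <= l)%N ->
     cabs (z k - z l) <= e) ->
  exists w, forall e : R, 0 < e -> exists k0, forall k, (k0 <= k)%N ->
    cabs (z k - w) <= e.
Proof.
move=> H.
have [a aP] : exists a : R, complex.Re (z k) @[k --> \oo] --> a.
  apply: real_cauchy_cvg => e e0; have [k0 kP] := H e e0.
  exists k0 => k l kk ll; have [h _ _] := cabs_ReIm (z k - z l).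
  by apply: le_trans (kP k l kk ll); rewrite raddfB in h.
have [b bP] : exists b : R, complex.Im (z k) @[k --> \oo] --> b.
  apply: real_cauchy_cvg => e e0; have [k0 kP] := H e e0.
  exists k0 => k l kk ll; have [_ h _] := cabs_ReIm (z k - z l).
  by apply: le_trans (kP k l kk ll); rewrite raddfB in h.
exists (a +i* b)%C => e e0; have e2 : 0 < e / 2 by rewrite divr_gt0.
have [ka aE] := (cvg_realP _ _).1 aP _ e2.
have [kb bE] := (cvg_realP _ _).1 bP _ e2.
exists (maxn ka kb) => k; rewrite geq_max => /andP[kak kbk].
have [_ _] := cabs_ReIm (z k - (a +i* b)%C); rewrite 2!raddfB /= => h.
by apply: le_trans h _; rewrite [e]splitr lerD ?aE ?bE.
Qed.

Hypothesis cG : compact [set: G].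
Variable g0 : G.

Lemma haagerup_cauchy_le u (e : R) : haagerup_cauchy u -> 0 < e ->
  exists k0, forall k l, (k0 <= k)%N -> (k0 <= l)%N -> N (u k - u l) <= e.
Proof.
move=> [_ cu] e0; have [k0 kP] := cu e e0.
by exists k0 => k l kk ll; apply/ltW/kP.
Qed.

Lemma haagerup_cauchy_uniform u : haagerup_cauchy u ->
  exists f, {uniform, u @ \oo --> f}.
Proof.
move=> cu; have au := cu.1.
have dist k l x : cabs (u k x - u l x) <= N (u k - u l).
  exact: (cabs_le_haagerup cG x (alg_tensorB (au k) (au l))).
have /choice [f fP] x : exists w, forall e : R, 0 < e ->
    exists k0, forall k, (k0 <= k)%N -> cabs (u k x - w) <= e.
  apply: complex_cauchy_cvg => e e0; have [k0 kP] := haagerup_cauchy_le cu e0.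
  by exists k0 => k l kk ll; apply: le_trans (kP k l kk ll).
exists f; apply/uniform_cvgP => e e0; have [k0 kP] := haagerup_cauchy_le cu e0.
exists k0 => k kk x; apply/ler_addgt0Pr => d d0.
(* The index [l] depends on the point x, but the resulting bound e + d does not. *)
have [k1 k1P] := fP x d d0; pose l := maxn k0 k1.
have -> : u k x - f x = (u k x - u l x) + (u l x - f x) by rewrite addrA subrK.
apply: le_trans (cabsD _ _) _; apply: lerD; last exact/k1P/leq_maxr.
by apply: le_trans (dist k l x) _; apply: kP => //; exact: leq_maxl.
Qed.

Lemma haagerup_cauchy_norm_cvg u : haagerup_cauchy u ->
  exists r : R, N (u k) @[k --> \oo] --> r.
Proof.
move=> cu; apply: real_cauchy_cvg => e e0.
have [k0 kP] := haagerup_cauchy_le cu e0.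
exists k0 => k l kk ll; apply: le_trans (kP k l kk ll).
by apply: haagerup_norm_dist => //; exact: cu.1.
Qed.

Lemma haagerup_cauchy_bounded u : haagerup_cauchy u ->
  exists B : R, 0 < B /\ exists k0, forall k, (k0 <= k)%N -> N (u k) <= B.
Proof.
move=> cu; have [k0 kP] := haagerup_cauchy_le cu ltr01.
exists (1 + N (u k0)); split.
  by rewrite ltr_pwDl // haagerup_norm_ge0.
exists k0 => k kk; apply: le_trans (lerD (kP k k0 kk (leqnn _)) (lexx _)).
rewrite -{1}(subrK (u k0) (u k)); apply: haagerup_normD => //.
  by apply: alg_tensorB; exact: cu.1.
exact: cu.1.
Qed.

Lemma haagerup_cauchyB u v : haagerup_cauchy u -> haagerup_cauchy v ->
  haagerup_cauchy (fun k => u k - v k).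
Proof.
move=> cu cv; split=> [k|e e0]; first by apply: alg_tensorB; [exact: cu.1|exact: cv.1].
have e2 : 0 < e / 2 by rewrite divr_gt0.
have [k1 k1P] := cu.2 _ e2; have [k2 k2P] := cv.2 _ e2.
exists (maxn k1 k2) => k l; rewrite !geq_max => /andP[k1k k2k] /andP[k1l k2l].
have -> : u k - v k - (u l - v l) = (u k - u l) + (v l - v k).
  by apply/funext => x; rewrite !fctE; ring.
rewrite [e]splitr; apply: le_lt_trans (haagerup_normD _ _ _) (ltrD _ _) => //.
- by apply: alg_tensorB; exact: cu.1.
- by apply: alg_tensorB; exact: cv.1.
- exact: k1P.
- exact: k2P.
Qed.

(* Injectivity of the map from the completion to the functions on G^(n+1). *)
Lemma haagerup_cauchy_null u : haagerup_cauchy u ->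
  {uniform, u @ \oo --> (0 : funs)} -> N (u k) @[k --> \oo] --> (0 : R).
Proof.
move=> cu /uniform_cvgP u0; apply/cvg_realP => e e0.
have [k0 kP] := haagerup_cauchy_le cu e0.
exists k0 => k kk; rewrite subr0 ger0_norm ?haagerup_norm_ge0 //.
apply: (haagerup_norm_lsc cG g0); first exact: cu.1.
move=> d d0; have [k1 k1P] := u0 d d0; pose l := maxn k0 k1.
exists (u k - u l); split; first by apply: alg_tensorB; exact: cu.1.
  by apply: kP => //; exact: leq_maxl.
move=> x; have := k1P l (leq_maxr _ _) x.
have -> : u k x - (u k - u l) x = u l x by rewrite !fctE; ring.
by rewrite subr0.
Qed.

(** The difference of the two sequences is Cauchy and tends uniformly to 0, hence is null by
    [haagerup_cauchy_null]. This makes the choice in [Vn_norm] unambiguous. *)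
Lemma represents_norm_unique u v f (r s : R) : represents u f -> represents v f ->
  N (u k) @[k --> \oo] --> r -> N (v k) @[k --> \oo] --> s -> r = s.
Proof.
move=> [cu /uniform_cvgP uf] [cv /uniform_cvgP vf] ur vs.
have cw := haagerup_cauchyB cu cv.
have w0 : N (u k - v k) @[k --> \oo] --> (0 : R).
  apply: haagerup_cauchy_null => //; apply/uniform_cvgP => e e0.
  have e2 : 0 < e / 2 by rewrite divr_gt0.
  have [k1 k1P] := uf _ e2; have [k2 k2P] := vf _ e2.
  exists (maxn k1 k2) => k; rewrite geq_max => /andP[k1k k2k] x.
  have -> : (u k - v k) x - (0 : funs) x = (u k x - f x) + (f x - v k x).
    by rewrite subr0 addrA subrK.
  apply: le_trans (cabsD _ _) _; rewrite [e]splitr lerD ?k1P //.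
  by rewrite cabsB k2P.
apply/eqP; rewrite -subr_eq0 -normr_eq0 eq_le normr_ge0 andbT.
have H : `|N (u k) - N (v k)| @[k --> \oo] --> `|r - s|.
  by apply: cvg_norm; exact: cvgB.
apply: (ler_cvg_to H w0); apply: nearW => k.
by apply: haagerup_norm_dist => //; [exact: cu.1|exact: cv.1].
Qed.

Lemma Vn_normP u f : represents u f -> N (u k) @[k --> \oo] --> Vn_norm f.
Proof.
move=> uf; have [r ur] := haagerup_cauchy_norm_cvg uf.1.
rewrite (_ : Vn_norm f = r) //; apply: xget_unique; first by exists u.
by move=> s [v vf vs]; exact: (represents_norm_unique vf uf).
Qed.

Lemma represents_continuous u f : represents u f ->
  continuous (f : {ptws 'I_n.+1 -> G} -> K).
Proof.
move=> [cu uf].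
apply: (@uniform_limit_continuous {ptws 'I_n.+1 -> G} K (u @ \oo) f) => //.
by exists 0%N => // k _ /=; apply: alg_tensor_continuous; exact: cu.1.
Qed.

Lemma represents_cst f : alg_tensor f -> represents (fun=> f) f.
Proof.
move=> af; split.
  by split=> // e e0; exists 0%N => k l _ _; rewrite subrr haagerup_norm0.
by apply/uniform_cvgP => e e0; exists 0%N => k _ x; rewrite subrr cabs0 ltW.
Qed.

Lemma Vn_alg f : alg_tensor f -> Vn f.
Proof. by move=> af; exists (fun=> f); exact: represents_cst. Qed.

Lemma Vn_norm_alg f : alg_tensor f -> Vn_norm f = N f.
Proof.
move=> af; have := Vn_normP (represents_cst af).
move=> H; apply/eqP; rewrite eq_sym; apply/eqP.
exact: (cvg_unique _ (cvg_cst (N f)) H).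
Qed.

Lemma representsZ u f (c : K) : represents u f ->
  represents (fun k => c *: u k) (c *: f).
Proof.
move=> [cu /uniform_cvgP uf].
have c1 : 0 < cabs c + 1 by rewrite ltr_wpDl // cabs_ge0.
have cc : cabs c < cabs c + 1 by rewrite ltrDl.
split; first split=> [k|e e0].
- by apply: alg_tensorZ; exact: cu.1.
- have [k0 kP] := cu.2 _ (divr_gt0 e0 c1).
  exists k0 => k l kk ll; rewrite -scalerBr haagerup_normZ //; last first.
    by apply: alg_tensorB; exact: cu.1.
  have := kP k l kk ll; rewrite ltr_pdivlMr // mulrC; apply: le_lt_trans.
  by rewrite ler_wpM2r ?haagerup_norm_ge0 ?ltW.
- apply/uniform_cvgP => e e0; have [k0 kP] := uf _ (divr_gt0 e0 c1).
  exists k0 => k kk x; have := kP k kk x.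
  rewrite ler_pdivlMr // mulrC; apply: le_trans.
  have -> : (c *: u k) x - (c *: f) x = c * (u k x - f x) by rewrite mulrBr.
  by rewrite cabsM ler_wpM2r ?cabs_ge0 ?ltW.
Qed.

Lemma representsB u v f g : represents u f -> represents v g ->
  represents (fun k => u k - v k) (f - g).
Proof.
move=> [cu /uniform_cvgP uf] [cv /uniform_cvgP vg].
split; first exact: haagerup_cauchyB.
apply/uniform_cvgP => e e0; have e2 : 0 < e / 2 by rewrite divr_gt0.
have [k1 k1P] := uf _ e2; have [k2 k2P] := vg _ e2.
exists (maxn k1 k2) => k; rewrite geq_max => /andP[k1k k2k] x.
have -> : (u k - v k) x - (f - g) x = (u k x - f x) + (g x - v k x).
  by rewrite !fctE; ring.
apply: le_trans (cabsD _ _) _; rewrite [e]splitr lerD ?k1P //.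
by rewrite cabsB k2P.
Qed.

Lemma representsD u v f g : represents u f -> represents v g ->
  represents (fun k => u k + v k) (f + g).
Proof.
move=> uf vg; have := representsB uf (representsZ (-1) vg).
rewrite scaleN1r opprK (_ : (fun k => u k - -1 *: v k) = fun k => u k + v k) //.
by apply/funext => k; rewrite scaleN1r opprK.
Qed.

Lemma cabs_le_Vn_norm u f x : represents u f -> cabs (f x) <= Vn_norm f.
Proof.
move=> uf; apply/ler_addgt0Pr => e e0; have e2 : 0 < e / 2 by rewrite divr_gt0.
have [k1 k1P] := (cvg_realP _ _).1 (Vn_normP uf) _ e2.
have [k2 k2P] := (uniform_cvgP _ _).1 uf.2 _ e2.
pose k := maxn k1 k2.
have h1 := k1P k (leq_maxl _ _); have h2 := k2P k (leq_maxr _ _) x.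
have h3 := cabs_le_haagerup cG x (uf.1.1 k).
have : cabs (f x) <= cabs (f x - u k x) + cabs (u k x).
  by rewrite -{1}(subrK (u k x) (f x)) cabsD.
move: h1; rewrite cabsB ler_norml => /andP[_ h1] h4.
rewrite [e]splitr; apply: le_trans h4 _.
by rewrite addrC addrA lerD // -lerBlDl (le_trans _ h1) // lerB.
Qed.

(** Both the Cauchy property and the uniform limit come from splitting a difference of products into
    two terms, each with one small factor and one bounded factor. *)
Lemma representsM u v f g : represents u f -> represents v g ->
  represents (fun k x => u k x * v k x) (fun x => f x * g x).
Proof.
move=> uf vg.
have [B [B0 [kB uB]]] := haagerup_cauchy_bounded uf.1.
have [C [C0 [kC vC]]] := haagerup_cauchy_bounded vg.1.
have au := uf.1.1; have av := vg.1.1.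
have BC : 0 < B + C + 1 by rewrite !addr_gt0.
split; first split=> [k|e e0].
- exact: alg_tensorM.
(* The two terms add up to e (B + C) / (B + C + 1), strictly less than e. *)
- have e3 : 0 < e / (B + C + 1) by rewrite divr_gt0.
  have [k1 k1P] := uf.1.2 _ e3; have [k2 k2P] := vg.1.2 _ e3.
  exists (maxn (maxn k1 k2) (maxn kB kC)) => k l.
  rewrite !geq_max => /andP[/andP[k1k k2k] /andP[kBk kCk]].
  move=> /andP[/andP[k1l k2l] /andP[kBl kCl]].
  pose p : funs := fun x => (u k - u l) x * v k x.
  pose q : funs := fun x => u l x * (v k - v l) x.
  have -> : (fun x => u k x * v k x) - (fun x => u l x * v l x) = p + q.
    by apply/funext => x; rewrite /p /q !fctE; ring.
  have auv := alg_tensorB (au k) (au l); have avv := alg_tensorB (av k) (av l).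
  have hp : N p <= e / (B + C + 1) * C.
    apply: le_trans (haagerup_normM cG auv (av k)) _.
    by apply: ler_pM; rewrite ?haagerup_norm_ge0 ?vC // ltW ?k1P.
  have hq : N q <= B * (e / (B + C + 1)).
    apply: le_trans (haagerup_normM cG (au l) avv) _.
    by apply: ler_pM; rewrite ?haagerup_norm_ge0 ?uB // ltW ?k2P.
  apply: le_lt_trans (haagerup_normD cG (alg_tensorM auv _) (alg_tensorM _ avv)) _ => //.
  apply: le_lt_trans (lerD hp hq) _.
  rewrite [B * _]mulrC -mulrDr mulrAC ltr_pdivrMr // ltr_pM2l //.
  by rewrite [C + B]addrC ltrDl.
- apply/uniform_cvgP => e e0.
  (* For the limit, [Vn_norm f] is the uniform bound on f that replaces [B]. *)
  have F0 : 0 <= Vn_norm f.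
    by apply: le_trans (cabs_le_Vn_norm (fun=> g0) uf); exact: cabs_ge0.
  have FC : 0 < Vn_norm f + C + 1 by rewrite addr_gt0 // ltr_wpDl.
  have e3 : 0 < e / (Vn_norm f + C + 1) by rewrite divr_gt0.
  have [k1 k1P] := (uniform_cvgP _ _).1 uf.2 _ e3.
  have [k2 k2P] := (uniform_cvgP _ _).1 vg.2 _ e3.
  exists (maxn (maxn k1 k2) kC) => k; rewrite !geq_max.
  move=> /andP[/andP[k1k k2k] kCk] x.
  have -> : u k x * v k x - f x * g x =
      (u k x - f x) * v k x + f x * (v k x - g x) by ring.
  apply: le_trans (cabsD _ _) _; rewrite !cabsM.
  have h1 : cabs (u k x - f x) * cabs (v k x) <= e / (Vn_norm f + C + 1) * C.
    apply: ler_pM; rewrite ?cabs_ge0 ?k1P //.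
    by apply: le_trans (vC k kCk); exact: (cabs_le_haagerup cG).
  have h2 : cabs (f x) * cabs (v k x - g x) <=
      Vn_norm f * (e / (Vn_norm f + C + 1)).
    by apply: ler_pM; rewrite ?cabs_ge0 ?k2P // (cabs_le_Vn_norm x uf).
  apply: le_trans (lerD h1 h2) _.
  rewrite [Vn_norm f * _]mulrC -mulrDr mulrAC ler_pdivrMr // ler_pM2l //.
  by rewrite [C + _]addrC lerDl.
Qed.

(** For fixed k the function u k - f is represented by the sequence u k - u l in l, whose norms are
    eventually at most e. *)
Lemma Vn_norm_tail u f (e : R) k0 : represents u f ->
  (forall k l, (k0 <= k)%N -> (k0 <= l)%N -> N (u k - u l) <= e) ->
  forall k, (k0 <= k)%N -> Vn_norm (u k - f) <= e.
Proof.
move=> uf ue k kk.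
have := Vn_normP (representsB (represents_cst (uf.1.1 k)) uf).
move=> H; apply: (ler_cvg_to H (cvg_cst e)).
by exists k0 => // l ll; exact: ue.
Qed.

End Completion.

(** * Norm axioms and completeness of the completed algebra *)

Section BanachAlgebra.
Variables (R : realType) (G : topologicalType) (n : nat).
Local Notation K := (Cplx R).
Local Notation funs := (('I_n.+1 -> G) -> K).
Local Notation N := (@haagerup_norm R G n).
Implicit Types f g : funs.
Hypothesis cG : compact [set: G].
Variable g0 : G.

Lemma Vn_norm_ge0 f : Vn f -> 0 <= Vn_norm f.
Proof.
move=> [u uf]; apply: le_trans (cabs_le_Vn_norm cG g0 (fun=> g0) uf).
exact: cabs_ge0.
Qed.

Lemma Vn_norm_eq0 f : Vn f -> Vn_norm f = 0 -> f = 0.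
Proof.
move=> [u uf] f0; apply/funext => x; apply/cabs_eq0/eqP.
by rewrite eq_le cabs_ge0 -f0 (cabs_le_Vn_norm cG g0 x uf).
Qed.

Lemma VnD f g : Vn f -> Vn g -> Vn (f + g).
Proof. by move=> [u uf] [v vg]; eexists; exact: representsD uf vg. Qed.

Lemma VnZ (c : K) f : Vn f -> Vn (c *: f).
Proof. by move=> [u uf]; eexists; exact: representsZ uf. Qed.

Lemma VnB f g : Vn f -> Vn g -> Vn (f - g).
Proof. by move=> [u uf] [v vg]; eexists; exact: representsB uf vg. Qed.

Lemma VnM f g : Vn f -> Vn g -> Vn (fun x => f x * g x).
Proof. by move=> [u uf] [v vg]; eexists; exact: representsM uf vg. Qed.

Lemma Vn_normD f g : Vn f -> Vn g -> Vn_norm (f + g) <= Vn_norm f + Vn_norm g.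
Proof.
move=> [u uf] [v vg].
have H := Vn_normP cG g0 (representsD cG uf vg).
have H' : N (u k) + N (v k) @[k --> \oo] --> Vn_norm f + Vn_norm g.
  by apply: cvgD; [exact: (Vn_normP cG g0 uf)|exact: (Vn_normP cG g0 vg)].
apply: (ler_cvg_to H H'); apply: nearW => k.
by apply: haagerup_normD => //; [exact: uf.1.1|exact: vg.1.1].
Qed.

Lemma Vn_normM f g : Vn f -> Vn g ->
  Vn_norm (fun x => f x * g x) <= Vn_norm f * Vn_norm g.
Proof.
move=> [u uf] [v vg].
have H := Vn_normP cG g0 (representsM cG g0 uf vg).
have H' : N (u k) * N (v k) @[k --> \oo] --> Vn_norm f * Vn_norm g.
  by apply: cvgM; [exact: (Vn_normP cG g0 uf)|exact: (Vn_normP cG g0 vg)].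
apply: (ler_cvg_to H H'); apply: nearW => k.
by apply: haagerup_normM => //; [exact: uf.1.1|exact: vg.1.1].
Qed.

Lemma Vn_normZ (c : K) f : Vn f -> Vn_norm (c *: f) = cabs c * Vn_norm f.
Proof.
move=> [u uf]; have H := Vn_normP cG g0 (representsZ cG c uf).
have H' : cabs c * N (u k) @[k --> \oo] --> cabs c * Vn_norm f.
  by apply: cvgM; [exact: cvg_cst|exact: (Vn_normP cG g0 uf)].
have NE : (fun k => N (c *: u k)) = fun k => cabs c * N (u k).
  by apply/funext => k; apply: haagerup_normZ => //; exact: uf.1.1.
by move: H; rewrite NE => H; exact: (cvg_unique _ H H').
Qed.

Lemma Vn_normBC f g : Vn f -> Vn g -> Vn_norm (f - g) = Vn_norm (g - f).
Proof.
move=> Vf Vg; rewrite -(opprB g f) -scaleN1r Vn_normZ ?cabsN ?cabs1 ?mul1r //.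
exact: VnB.
Qed.

Lemma Vn_approx f (e : R) : Vn f -> 0 < e ->
  exists v, alg_tensor v /\ Vn_norm (f - v) <= e.
Proof.
move=> Vf e0; have [u uf] := Vf; have [k0 kP] := haagerup_cauchy_le uf.1 e0.
exists (u k0); split; first exact: uf.1.1.
rewrite Vn_normBC //; last by apply: Vn_alg => //; exact: uf.1.1.
exact: (Vn_norm_tail cG g0 uf kP (leqnn _)).
Qed.

(** A diagonal argument: each u k is replaced by an algebraic tensor v k within 1 / (k + 1). The
    sequence v is Haagerup-Cauchy, and the function it represents is the limit of u. *)
Lemma Vn_complete (u : nat -> funs) : (forall k, Vn (u k)) ->
  cauchy_for (@Vn_norm R G n) u ->
  exists2 f, Vn f & Vn_norm (u k - f) @[k --> \oo] --> (0 : R).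
Proof.
move=> Vu cu.
have /choice [v vP] k : exists v, alg_tensor v /\ Vn_norm (u k - v) <= k.+1%:R^-1.
  by apply: Vn_approx; rewrite ?invr_gt0.
have av k : alg_tensor (v k) by case: (vP k).
have Vv k : Vn (v k) by exact: Vn_alg.
have small (e : R) : 0 < e -> exists k0, forall k, (k0 <= k)%N ->
    Vn_norm (u k - v k) <= e.
  move=> e0; have [k0 _ kP] := near_infty_natSinv_lt (PosNum e0).
  by exists k0 => k kk; apply: le_trans (proj2 (vP k)) _; apply/ltW/kP.
have cv : haagerup_cauchy v.
  split=> // e e0; have e3 : 0 < e / 3 by rewrite divr_gt0.
  have [k1 k1P] := small _ e3; have [k2 k2P] := cu _ e3.
  exists (maxn k1 k2) => k l; rewrite !geq_max => /andP[k1k k2k] /andP[k1l k2l].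
  rewrite -(Vn_norm_alg cG g0 (alg_tensorB (av k) (av l))).
  have -> : v k - v l = (v k - u k) + ((u k - u l) + (u l - v l)).
    by rewrite !addrA !subrK.
  apply: le_lt_trans (Vn_normD (VnB _ _) (VnD (VnB _ _) (VnB _ _))) _ => //.
  apply: le_lt_trans (lerD (lexx _) (Vn_normD (VnB _ _) (VnB _ _))) _ => //.
  rewrite (Vn_normBC (Vv k) (Vu k)).
  have := k1P k k1k; have := k1P l k1l; have := k2P k l k2k k2l.
  lra.
have [f vf] := haagerup_cauchy_uniform cG cv.
have rf : represents v f by [].
have Vf : Vn f by exists v.
exists f => //; apply/cvg_realP => e e0; have e2 : 0 < e / 2 by rewrite divr_gt0.
have [k1 k1P] := small _ e2; have [k2 k2P] := haagerup_cauchy_le cv e2.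
exists (maxn k1 k2) => k; rewrite geq_max => /andP[k1k k2k].
rewrite subr0 ger0_norm ?Vn_norm_ge0 //; last exact: VnB.
have -> : u k - f = (u k - v k) + (v k - f) by rewrite addrA subrK.
apply: le_trans (Vn_normD (VnB _ _) (VnB _ _)) _ => //.
rewrite [e]splitr lerD ?k1P //.
exact: (Vn_norm_tail cG g0 rf k2P k2k).
Qed.

End BanachAlgebra.

Theorem lemma3p2 (R : realType) (G : topologicalGroupType) (n : nat)
    (G_compact : compact [set: G]) (G_hausdorff : hausdorff_space G)
    (n_ge1 : (1 <= n)%N) :
  (* the completion is a space of continuous functions on G^(n+1) *)
  (forall u : nat -> ('I_n.+1 -> G) -> Cplx R, haagerup_cauchy u ->
    exists f : ('I_n.+1 -> G) -> Cplx R,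
      [/\ continuous (f : {ptws 'I_n.+1 -> G} -> Cplx R),
          represents u f
        & haagerup_norm (u k) @[k --> \oo] --> Vn_norm f]) /\
  commutative_banach_algebra
    (E := ('I_n.+1 -> G) -> Cplx R)
    (@Vn R G n)
    (fun f g x => f x * g x)
    (@Vn_norm R G n).
Proof.
(* The group unit shows that [G] is inhabited, which provides the point required by the averaging
   argument. *)
have g1 : G := 1%g.
split=> [u cu|].
  have [f uf] := haagerup_cauchy_uniform G_compact cu.
  exists f; split => //; first exact: represents_continuous (conj cu uf).
  exact: (Vn_normP G_compact g1 (conj cu uf)).
split.
- exact/Vn_alg/alg_tensor0.
- exact: (VnD G_compact).
- exact: (VnZ G_compact).
- exact: (VnM G_compact).
- by move=> f g h _ _ _; apply/funext => x; rewrite mulrA.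
- by move=> f g _ _; apply/funext => x; rewrite mulrC.
- by move=> f g h _ _ _; apply/funext => x; rewrite !fctE mulrDl.
- by move=> c f g _ _; apply/funext => x; rewrite !fctE -mulrA.
- exact: (Vn_norm_ge0 G_compact).
- exact: (Vn_norm_eq0 G_compact).
- exact: (Vn_normD G_compact).
- exact: (Vn_normZ G_compact).
- exact: (Vn_normM G_compact).
- exact: (Vn_complete G_compact).
Qed.
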